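(* Let $P,Q\subset\mathbb{R}^3$ each be either an equiprojective polytope, a polygon, or a line segment. If the Minkowski sum $P+Q$ is an equiprojective polytope, then $$\kappa(P+Q)=\kappa(P)+\kappa(Q)-\lambda(P,Q).$$
   Context: A $3$-dimensional polytope $P\subset\mathbb{R}^3$ is $k$-equiprojective when its orthogonal projection onto any plane not orthogonal to a facet of $P$ is a polygon with exactly $k$ vertices; equiprojective means $k$-equiprojective for some $k$. For a polytope $P\subset\mathbb{R}^3$ (any dimension) and a face $F$, $N_P(F)=\{u\in\mathbb{R}^3:\ u\cdot x\le u\cdot y\ \forall x\in P, y\in F\}$. For non-zero $u$, the aggregated cone $C_P(u)$ is the union of the $2$-dimensional normal cones of $P$ contained in the plane $u^\perp$. A vector $u\in\mathbb{S}^2$ is an edge direction of $P$ when its first non-zero coordinate is positive and some edge of $P$ has difference of vertices a multiple of $u$. The multiplicity $\mu_P(u)$ is $2$ if $C_P(u)=u^\perp$ and $1$ otherwise. If $P$ is equiprojective, $\kappa(P)$ is the $k$ such that $P$ is $k$-equiprojective; if $P$ is a polygon or a line segment, $\kappa(P)=\sum_u\mu_P(u)$ over the edge directions $u$ of $P$ (equal to the number of edges for a polygon and to $2$ for a segment). Finally, $\lambda(P,Q)=k+2k'$, where $k'$ is the number of edge directions $u$ common to $P$ and $Q$ with $C_P(u)=C_Q(u)=u^\perp$, and $k$ is the number of edge directions $u$ common to $P$ and $Q$ such that at least one of $C_P(u),C_Q(u)$ is distinct from $u^\perp$ and one of these two cones is contained in the other. *)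

(* Defs.v *)
From mathcomp Require Import all_boot all_order all_algebra.
From mathcomp Require Import boolp reals.
Set Implicit Arguments. Unset Strict Implicit. Unset Printing Implicit Defensive.
Import Order.TTheory GRing.Theory Num.Theory.
Local Open Scope ring_scope.

Section Polytopes.
Variable R : realType.

Definition vec := 'rV[R]_3.
Definition dot (u v : vec) : R := \sum_(i < 3) u 0 i * v 0 i.

Definition seteq (A B : vec -> Prop) := forall x, A x <-> B x.
Definition subset (A B : vec -> Prop) := forall x, A x -> B x.

Definition conv (V : seq vec) (x : vec) : Prop :=
  exists w : 'I_(size V) -> R,
    (forall i, 0 <= w i) /\ \sum_i w i = 1 /\ x = \sum_i w i *: V`_i.

Definition polytope (P : vec -> Prop) := exists V : seq vec, seteq P (conv V).

Definition lin_indep (k : nat) (f : 'I_k -> vec) :=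
  forall c : 'I_k -> R, \sum_i c i *: f i = 0 -> forall i, c i = 0.

Definition ldim (S : vec -> Prop) (d : nat) :=
  (exists f : 'I_d -> vec, (forall i, S (f i)) /\ lin_indep f) /\
  (forall f : 'I_d.+1 -> vec, (forall i, S (f i)) -> ~ lin_indep f).

Definition adim (S : vec -> Prop) (d : nat) :=
  (exists x, S x) /\ ldim (fun v => exists x y, S x /\ S y /\ v = x - y) d.

Definition maximizer (P : vec -> Prop) (u x : vec) :=
  P x /\ forall y, P y -> dot u y <= dot u x.
Definition face (P F : vec -> Prop) :=
  exists u, (exists x, maximizer P u x) /\ seteq F (maximizer P u).
Definition vertex (P : vec -> Prop) (v : vec) := face P (fun x => x = v).
Definition edge (P F : vec -> Prop) := face P F /\ adim F 1.
Definition facet (P F : vec -> Prop) := face P F /\ adim F 2.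

Definition normal_cone (P F : vec -> Prop) (u : vec) :=
  forall x y, P x -> F y -> dot u x <= dot u y.

Definition orth (u v : vec) := dot u v = 0.

Definition agg_cone (P : vec -> Prop) (u : vec) (w : vec) :=
  exists F, face P F /\ ldim (normal_cone P F) 2 /\
            subset (normal_cone P F) (orth u) /\ normal_cone P F w.

Definition cfull (P : vec -> Prop) (u : vec) := seteq (agg_cone P u) (orth u).

Definition first_nonzero_pos (u : vec) :=
  0 < u 0 (inord 0) \/
  (u 0 (inord 0) = 0 /\ 0 < u 0 (inord 1)) \/
  (u 0 (inord 0) = 0 /\ u 0 (inord 1) = 0 /\ 0 < u 0 (inord 2)).
Definition edge_dir (P : vec -> Prop) (u : vec) :=
  dot u u = 1 /\ first_nonzero_pos u /\
  exists E a b c, edge P E /\ vertex P a /\ vertex P b /\ E a /\ E b /\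
                  a != b /\ b - a = c *: u.

Definition mult (P : vec -> Prop) (u : vec) : nat :=
  if `[< cfull P u >] then 2%N else 1%N.

Definition proj (u x : vec) : vec := x - (dot x u / dot u u) *: u.
Definition proj_set (u : vec) (P : vec -> Prop) (y : vec) :=
  exists x, P x /\ y = proj u x.

Definition polygon (P : vec -> Prop) := polytope P /\ adim P 2.
Definition segment (P : vec -> Prop) := polytope P /\ adim P 1.
Definition polytope3 (P : vec -> Prop) := polytope P /\ adim P 3.

Definition nvertices (P : vec -> Prop) (k : nat) :=
  exists s : seq vec, uniq s /\ size s = k /\ forall v, v \in s <-> vertex P v.

Definition k_equiprojective (P : vec -> Prop) (k : nat) :=
  polytope3 P /\
  forall u : vec, u != 0 ->
    (forall F n, facet P F -> normal_cone P F n -> n != 0 -> dot u n <> 0) ->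
    polygon (proj_set u P) /\ nvertices (proj_set u P) k.

Definition equiprojective (P : vec -> Prop) := exists k, k_equiprojective P k.

Definition minkowski (P Q : vec -> Prop) (z : vec) :=
  exists x y, P x /\ Q y /\ z = x + y.

Definition kappa (P : vec -> Prop) (k : nat) :=
  k_equiprojective P k \/
  ((polygon P \/ segment P) /\
   exists s : seq vec, uniq s /\ (forall u, u \in s <-> edge_dir P u) /\
     k = (\sum_(u <- s) mult P u)%N).

Definition lambda (P Q : vec -> Prop) (l : nat) :=
  exists s1 s2 : seq vec, uniq s1 /\ uniq s2 /\
   (forall u, u \in s1 <->
      edge_dir P u /\ edge_dir Q u /\ (~ cfull P u \/ ~ cfull Q u) /\
      (subset (agg_cone P u) (agg_cone Q u) \/
       subset (agg_cone Q u) (agg_cone P u))) /\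
   (forall u, u \in s2 <->
      edge_dir P u /\ edge_dir Q u /\ cfull P u /\ cfull Q u) /\
   l = (size s1 + 2 * size s2)%N.

End Polytopes.

(* Main.v *)
Require Import Defs.
From mathcomp Require Import all_boot all_order all_algebra.
From mathcomp Require Import boolp reals.
From mathcomp Require Import ring lra.

(** For a generic vector [v], projecting along [v] maps the edges of [P] that lie on
    the silhouette bijectively onto the edges of a polygon: an edge of direction [u]
    is counted once for each of the rays spanned by [cross u v] and [- cross u v]
    that lies in the aggregated cone of [u]. So the number of vertices of the
    projection is the sum, over the edge directions [u], of the number (0, 1 or 2)
    of these rays contained in the cone.

    Equiprojectivity makes each of these numbers independent of [v]. Indeed, let [v]
    approach an edge direction [u0] as [u0 + e q] and as [u0 - e q]. For every
    direction [u] other than [u0] the two positions lie on the two sides of the plane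
    spanned by [u] and [u0], so the two counts for [u] have a sum that does not depend
    on [q]; the same then holds for [u0] itself, whose count only depends on the line
    spanned by [q]. The constant is the multiplicity of [u], so [kappa P] is the sum of
    the multiplicities. For polygons and segments this is immediate, because all the
    relevant planes coincide.

    Since the face of [P + Q] in a given direction is the sum of the faces of [P] and
    [Q], a ray lies in the cone of [P + Q] iff it lies in the cone of [P] or of [Q], and
    the formula follows by comparing the contributions of each edge direction. *)

Set Implicit Arguments. Unset Strict Implicit. Unset Printing Implicit Defensive.
Import Order.TTheory GRing.Theory Num.Theory.
Local Open Scope ring_scope.

(** * Coordinates, scalar products and cross products in three-space *)

Section Vectors.
Variable R : realType.
Implicit Types (a b c e : R) (d m n u v w x y z : vec R).

Definition cx u : R := u 0 (inord 0).
Definition cy u : R := u 0 (inord 1).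
Definition cz u : R := u 0 (inord 2).

Definition cross u v : vec R :=
  \row_(i < 3) [:: cy u * cz v - cz u * cy v; cz u * cx v - cx u * cz v;
                  cx u * cy v - cy u * cx v]`_i.

Lemma vec_eqP u v : cx u = cx v -> cy u = cy v -> cz u = cz v -> u = v.
Proof.
move=> ux uy uz; apply/rowP => i.
have -> : i = inord i by rewrite inord_val.
by case: i => -[|[|[|//]]].
Qed.

Lemma dotE u v : dot u v = cx u * cx v + cy u * cy v + cz u * cz v.
Proof.
rewrite /dot !big_ord_recl big_ord0 addr0 addrA; congr (_ * _ + _ * _ + _ * _);
  by congr (_ 0 _); apply/val_inj; rewrite /= inordK.
Qed.

Lemma coordD u v : (cx (u + v) = cx u + cx v) * (cy (u + v) = cy u + cy v) *
  (cz (u + v) = cz u + cz v).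
Proof. by rewrite /cx /cy /cz !mxE. Qed.

Lemma coordN u : (cx (- u) = - cx u) * (cy (- u) = - cy u) * (cz (- u) = - cz u).
Proof. by rewrite /cx /cy /cz !mxE. Qed.

Lemma coordZ c u : (cx (c *: u) = c * cx u) * (cy (c *: u) = c * cy u) *
  (cz (c *: u) = c * cz u).
Proof. by rewrite /cx /cy /cz !mxE. Qed.

Lemma coord0 : (cx 0 = 0) * (cy 0 = 0) * (cz 0 = 0).
Proof. by rewrite /cx /cy /cz !mxE. Qed.

Lemma coordX u v : (cx (cross u v) = cy u * cz v - cz u * cy v) *
  (cy (cross u v) = cz u * cx v - cx u * cz v) *
  (cz (cross u v) = cx u * cy v - cy u * cx v).
Proof. by split; [split|]; rewrite [LHS]mxE /= inordK. Qed.

Definition coordE := (dotE, coordX, coordD, coordN, coordZ, coord0).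

Lemma dotC u v : dot u v = dot v u.
Proof. by rewrite !coordE; ring. Qed.

Lemma dotDl u v w : dot (u + v) w = dot u w + dot v w.
Proof. by rewrite !coordE; ring. Qed.

Lemma dotDr u v w : dot w (u + v) = dot w u + dot w v.
Proof. by rewrite !coordE; ring. Qed.

Lemma dotNl u v : dot (- u) v = - dot u v.
Proof. by rewrite !coordE; ring. Qed.

Lemma dotNr u v : dot u (- v) = - dot u v.
Proof. by rewrite !coordE; ring. Qed.

Lemma dotZl c u v : dot (c *: u) v = c * dot u v.
Proof. by rewrite !coordE; ring. Qed.

Lemma dotZr c u v : dot u (c *: v) = c * dot u v.
Proof. by rewrite !coordE; ring. Qed.

Lemma dotBr u v w : dot w (u - v) = dot w u - dot w v.
Proof. by rewrite dotDr dotNr. Qed.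

Lemma dot0l u : dot 0 u = 0.
Proof. by rewrite !coordE; ring. Qed.

Lemma dot0r u : dot u 0 = 0.
Proof. by rewrite !coordE; ring. Qed.

Lemma dot_sumr (I : Type) (r : seq I) (Pr : pred I) (F : I -> vec R) u :
  dot u (\sum_(i <- r | Pr i) F i) = \sum_(i <- r | Pr i) dot u (F i).
Proof.
elim/big_rec2: _ => [|i y1 y2 _ <-]; first by rewrite dot0r.
by rewrite dotDr.
Qed.

Lemma dot_ge0 u : 0 <= dot u u.
Proof. by rewrite dotE; nra. Qed.

Lemma dot_eq0 u : (dot u u == 0) = (u == 0).
Proof.
apply/eqP/eqP => [|->]; last by rewrite dot0l.
rewrite dotE => h; apply: vec_eqP; rewrite !coordE; nra.
Qed.

Lemma dot_gt0 u : (0 < dot u u) = (u != 0).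
Proof. by rewrite lt_neqAle dot_ge0 andbT eq_sym dot_eq0. Qed.

Lemma crossNl u v : cross (- u) v = - cross u v.
Proof. by apply: vec_eqP; rewrite !coordE; ring. Qed.

Lemma crossNr u v : cross u (- v) = - cross u v.
Proof. by apply: vec_eqP; rewrite !coordE; ring. Qed.

Lemma crossC u v : cross u v = - cross v u.
Proof. by apply: vec_eqP; rewrite !coordE; ring. Qed.

Lemma crossZl c u v : cross (c *: u) v = c *: cross u v.
Proof. by apply: vec_eqP; rewrite !coordE; ring. Qed.

Lemma crossZr c u v : cross u (c *: v) = c *: cross u v.
Proof. by apply: vec_eqP; rewrite !coordE; ring. Qed.

Lemma crossDr u v w : cross u (v + w) = cross u v + cross u w.
Proof. by apply: vec_eqP; rewrite !coordE; ring. Qed.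

Lemma crossvv u : cross u u = 0.
Proof. by apply: vec_eqP; rewrite !coordE; ring. Qed.

Lemma cross0l u : cross 0 u = 0.
Proof. by apply: vec_eqP; rewrite !coordE; ring. Qed.

Lemma dot_crossl u v : dot (cross u v) u = 0.
Proof. by rewrite !coordE; ring. Qed.

Lemma dot_crossr u v : dot (cross u v) v = 0.
Proof. by rewrite !coordE; ring. Qed.

Lemma dot_cross_rot u v d : dot (cross u v) d = dot v (cross d u).
Proof. by rewrite !coordE; ring. Qed.

(** With [u] a unit vector this inverts [cross _ u] on the plane orthogonal to [u]: every [n] in
    that plane has the form [cross u v], with [v] equal to [cross n u]. *)
Lemma cross_cross_orth n u : dot n u = 0 -> cross u (cross n u) = dot u u *: n.
Proof.
rewrite !coordE => h.
apply: vec_eqP; rewrite !coordE.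
- transitivity ((cx u * cx u + cy u * cy u + cz u * cz u) * cx n
    - cx u * (cx n * cx u + cy n * cy u + cz n * cz u)); first by ring.
  by rewrite h; ring.
- transitivity ((cx u * cx u + cy u * cy u + cz u * cz u) * cy n
    - cy u * (cx n * cx u + cy n * cy u + cz n * cz u)); first by ring.
  by rewrite h; ring.
- transitivity ((cx u * cx u + cy u * cy u + cz u * cz u) * cz n
    - cz u * (cx n * cx u + cy n * cy u + cz n * cz u)); first by ring.
  by rewrite h; ring.
Qed.

Lemma cross_eq0P u v : u != 0 -> cross v u = 0 <-> exists c, v = c *: u.
Proof.
move=> u0; split=> [|[c ->]]; last by rewrite crossZl crossvv scaler0.
move=> h; exists (dot v u / dot u u).
have uu : dot u u != 0 by rewrite dot_eq0.
have hc : dot u u *: v = dot v u *: u.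
  have : cross u (cross v u) = 0 by rewrite h crossC cross0l oppr0.
  move=> h1; apply/eqP; rewrite -subr_eq0; apply/eqP.
  by rewrite -[RHS]h1; apply: vec_eqP; rewrite !coordE; ring.
by rewrite mulrC -scalerA -hc scalerA mulVf // scale1r.
Qed.

(** The triple product [cross n (cross u v)] expands to [dot n v *: u - dot n u *: v], which
    vanishes here. *)
Lemma orth2_parallel n u v : cross u v != 0 -> dot n u = 0 -> dot n v = 0 ->
  exists c, n = c *: cross u v.
Proof.
move=> uv0 nu nv; apply/cross_eq0P => //.
transitivity (dot n v *: u - dot n u *: v); last by rewrite nu nv !scale0r subr0.
by apply: vec_eqP; rewrite !coordE; ring.
Qed.

Lemma coplanar_cross d u v : cross u v != 0 -> dot d (cross u v) = 0 ->
  exists c, cross d u = c *: cross u v.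
Proof.
move=> uv0 h; apply: orth2_parallel => //; first by rewrite dot_crossr.
transitivity (dot d (cross u v)); last by [].
by rewrite !coordE; ring.
Qed.

Lemma scaler_neq0 c u : c != 0 -> u != 0 -> c *: u != 0.
Proof. by move=> c0 u0; rewrite scaler_eq0 negb_or c0. Qed.

End Vectors.

(** * Properties valid for all sufficiently small positive reals *)

Section Small.
Variable R : realType.
Implicit Types (a b e : R) (p q : R -> Prop).

(** The filter of right neighbourhoods of [0]. Its stability under finite conjunctions lets one [e]
    meet all the conditions imposed by finitely many points. *)
Definition small p := exists2 e0 : R, 0 < e0 & forall e, 0 < e < e0 -> p e.

Lemma small_ex p : small p -> exists2 e, 0 < e & p e.
Proof. by move=> [e0 h0 H]; exists (e0 / 2); [|apply: H]; lra. Qed.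

Lemma small_and p q : small p -> small q -> small (fun e => p e /\ q e).
Proof.
move=> [e1 h1 H1] [e2 h2 H2]; exists (Num.min e1 e2); first by rewrite lt_min h1.
by move=> e /andP[he]; rewrite lt_min => /andP[he1 he2]; split;
  [apply: H1 | apply: H2]; rewrite he.
Qed.

Lemma small_imp p q : (forall e, 0 < e -> p e -> q e) -> small p -> small q.
Proof.
move=> H [e0 h0 H0]; exists e0 => // e he; apply: H; last exact: H0.
by case/andP: he.
Qed.

Lemma small_pos p : (forall e, 0 < e -> p e) -> small p.
Proof. by move=> H; exists 1 => // e /andP[he _]; apply: H. Qed.

Lemma small_all (T : eqType) (s : seq T) (p : T -> R -> Prop) :
  (forall x, x \in s -> small (p x)) ->
  small (fun e => forall x, x \in s -> p x e).
Proof.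
elim: s => [|x s IH] H; first exact: small_pos.
have /small_and /(_ (H x (mem_head _ _))) : small (fun e => forall y, y \in s -> p y e).
  by apply: IH => y ys; apply: H; rewrite inE ys orbT.
apply: small_imp => e _ [h1 h2] y; rewrite inE => /predU1P[-> //|]; exact: h1.
Qed.

Lemma small_gt0 a b : 0 < a -> small (fun e => 0 < a + e * b).
Proof.
(* The summand [1] keeps the denominator positive when [b] is zero. *)
move=> a0; exists (a / (`|b| + 1)).
  by rewrite divr_gt0 // ltr_wpDl.
move=> e /andP[e0]; rewrite ltr_pdivlMr; last by rewrite ltr_wpDl.
move=> h; have : - `|b| <= b by rewrite lerNl ler_normr lexx orbT.
by nra.
Qed.

Lemma small_neq0 a b : (a = 0 -> b != 0) -> small (fun e => a + e * b != 0).
Proof.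
move=> h; case: (ltgtP a 0) => [a0|a0|a0].
- have : 0 < - a by lra.
  move=> /(small_gt0 (- b)); apply: small_imp => e _ H; apply/negP => /eqP; lra.
- by have := small_gt0 b a0; apply: small_imp => e _ H; rewrite gt_eqF.
- by apply: small_pos => e e0; rewrite a0 add0r mulf_neq0 ?h // gt_eqF.
Qed.

End Small.

(** * Faces of the hull of a finite list, and their behaviour under perturbation of the normal *)

Section Faces.
Variable R : realType.
Implicit Types (c e : R) (d m n u v w x y z : vec R) (P : vec R -> Prop).
Implicit Types (V : seq (vec R)).

Lemma conv_mem V x : x \in V -> conv V x.
Proof.
move=> xV; have hi : (index x V < size V)%N by rewrite index_mem.
exists (fun i => (i == Ordinal hi)%:R); split; first by move=> i; rewrite ler0n.
split.
  by rewrite (bigD1 (Ordinal hi)) //= eqxx big1 ?addr0 // => i /negPf ->.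
rewrite (bigD1 (Ordinal hi)) //= eqxx big1 => [|i /negPf ->]; last by rewrite scale0r.
by rewrite addr0 scale1r nth_index.
Qed.

Lemma conv_nil x : ~ conv [::] x.
Proof. by move=> [w [_ [+ _]]]; rewrite big_ord0 => /eqP; rewrite eq_sym oner_eq0. Qed.

(** The zero normal exposes the whole set, so results on faces apply to the hull itself. *)
Lemma maximizer0 P x : maximizer P 0 x <-> P x.
Proof. by split=> [[]//|Px]; split=> // y _; rewrite !dot0l. Qed.

Lemma maximizer_eq P n x y : maximizer P n x -> maximizer P n y -> dot n x = dot n y.
Proof. by move=> [Px hx] [Py hy]; apply/eqP; rewrite eq_le hx // hy. Qed.

Lemma maximizerP P n a x : maximizer P n a ->
  maximizer P n x <-> P x /\ dot n x = dot n a.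
Proof.
move=> Ma; split=> [Mx|[Px e]]; first by split; [case: Mx | apply: maximizer_eq Ma].
by split=> // y Py; rewrite e; apply: Ma.2.
Qed.

Lemma maximizerZ P n c x : 0 < c -> maximizer P (c *: n) x <-> maximizer P n x.
Proof.
move=> c0; have E y : (dot (c *: n) y <= dot (c *: n) x) = (dot n y <= dot n x).
  by rewrite !dotZl ler_pM2l.
by split=> -[Px h]; split=> // y Py; have := h y Py; rewrite E.
Qed.

(** A maximal convex combination puts no weight on non-maximal points, because the weighted gaps to
    the maximum are nonnegative and add up to zero. *)
Lemma face_bound V n m c :
  (forall y, y \in V -> maximizer (conv V) n y -> dot m y <= c) ->
  forall x, maximizer (conv V) n x -> dot m x <= c.
Proof.
move=> H x [[w [w0 [w1 xE]]] Mx].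
have V_in (i : 'I_(size V)) : V`_i \in V by apply: mem_nth; case: i.
have le_i (i : 'I_(size V)) : dot n V`_i <= dot n x by apply/Mx/conv_mem.
have s0 : \sum_i w i * (dot n x - dot n V`_i) = 0.
  under eq_bigr do rewrite mulrBr.
  rewrite sumrB -mulr_suml w1 mul1r {1}xE dot_sumr.
  by under eq_bigr do rewrite dotZr; rewrite subrr.
have t0 (i : 'I_(size V)) : w i * (dot n x - dot n V`_i) = 0.
  by apply: (psumr_eq0P _ s0) => // j _; rewrite mulr_ge0 // subr_ge0.
rewrite xE dot_sumr -[c]mul1r -w1 mulr_suml; apply: ler_sum => i _.
rewrite dotZr; have [->|wi0] := eqVneq (w i) 0; first by rewrite !mul0r.
rewrite ler_pM2l; last by rewrite lt_neqAle eq_sym wi0 w0.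
apply: H => //; split; first exact: conv_mem.
move=> y Py; have /eqP := t0 i; rewrite mulf_eq0 (negPf wi0) subr_eq0 /=.
by move=> /eqP <-; apply: Mx.
Qed.

Lemma conv_bound V m c : (forall y, y \in V -> dot m y <= c) ->
  forall x, conv V x -> dot m x <= c.
Proof. by move=> H x /maximizer0; apply: face_bound => y /H. Qed.

Lemma face_const V n m c :
  (forall y, y \in V -> maximizer (conv V) n y -> dot m y = c) ->
  forall x, maximizer (conv V) n x -> dot m x = c.
Proof.
move=> H x Mx; apply/eqP; rewrite eq_le; apply/andP; split.
  by apply: (face_bound _ Mx) => y yV /(H _ yV) ->.
rewrite -lerN2 -dotNl; apply: (face_bound _ Mx) => y yV /(H _ yV) <-.
by rewrite dotNl.
Qed.

Lemma maximizer_mem V n x : x \in V -> (forall y, y \in V -> dot n y <= dot n x) ->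
  maximizer (conv V) n x.
Proof. by move=> xV H; split; [apply: conv_mem | apply: conv_bound]. Qed.

Lemma list_max (T : eqType) (s : seq T) (f : T -> R) : s != [::] ->
  exists2 x : T, x \in s & forall y : T, y \in s -> f y <= f x.
Proof.
elim: s => [//|a [|b s] IH] _.
  by exists a; rewrite ?mem_head // => y; rewrite inE => /eqP ->.
have [//|x xs Hx] := IH; have [ax|/ltW xa] := leP (f a) (f x).
  exists x; first by rewrite inE xs orbT.
  by move=> y; rewrite inE => /predU1P[-> //|/Hx].
exists a; first exact: mem_head.
by move=> y; rewrite inE => /predU1P[-> //|/Hx /le_trans]; apply.
Qed.

Lemma maximizer_ex V n : V != [::] -> exists2 x, x \in V & maximizer (conv V) n x.
Proof.
by move=> /(list_max (dot n))[x xV H]; exists x => //; apply: maximizer_mem.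
Qed.

Lemma conv_neq0 V x : conv V x -> V != [::].
Proof. by case: V => [/conv_nil|]. Qed.

Lemma face_mem_ex V n x : conv V x -> exists2 a, a \in V & maximizer (conv V) n a.
Proof. by move=> /conv_neq0 /maximizer_ex. Qed.

(** For small [e], strict inequalities between the finitely many values of [n] on [V] survive, so
    [n + e *: z] is maximized lexicographically: by [n] first, and by [z] among ties. *)
Lemma perturb V n z : small (fun e => forall x,
  maximizer (conv V) (n + e *: z) x <-> maximizer (maximizer (conv V) n) z x).
Proof.
have : small (fun e => forall x, x \in V -> forall y, y \in V ->
    dot n x < dot n y -> dot (n + e *: z) x < dot (n + e *: z) y).
  apply: small_all => x _; apply: small_all => y _.
  have [lt_xy|le_yx] := ltP (dot n x) (dot n y); last exact: small_pos.
  have := @small_gt0 R (dot n y - dot n x) (dot z y - dot z x).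
  rewrite subr_gt0 => /(_ lt_xy); apply: small_imp => e _.
  by rewrite !dotDl !dotZl; lra.
apply: small_imp => e e0 H x.
have [Vn|V0] := eqVneq V [::].
  by rewrite Vn; split=> [[/conv_nil]|[[/conv_nil]]].
have [a0 a0V Ma0] := maximizer_ex n V0.
have : [seq y <- V | `[< maximizer (conv V) n y >]] != [::].
  apply/negP => /eqP E; have := in_nil a0; rewrite -E mem_filter a0V andbT.
  by move/asboolP.
(* [a] is lexicographically maximal in [V], so it serves as reference point for [n], for [z] on the
   face, and for [n + e *: z]. *)
move=> /(list_max (dot z)) [a]; rewrite mem_filter => /andP[/asboolP Ma aV] Ha.
have Mza : maximizer (maximizer (conv V) n) z a.
  split=> //; apply: face_bound => y yV My; apply: Ha.
  by rewrite mem_filter yV andbT; apply/asboolP.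
have eqz y : y \in V -> dot n y = dot n a -> dot z y <= dot z a.
  by move=> yV E; apply: Mza.2; apply/(maximizerP _ Ma); split=> //; apply: conv_mem.
have Mea : maximizer (conv V) (n + e *: z) a.
  apply: maximizer_mem => // y yV.
  have := Ma.2 _ (conv_mem yV); rewrite le_eqVlt => /predU1P[E|lt].
    by rewrite !dotDl !dotZl E lerD2l ler_pM2l // eqz.
  exact/ltW/H.
have Vea y : y \in V -> maximizer (conv V) (n + e *: z) y ->
    dot n y = dot n a /\ dot z y = dot z a.
  move=> yV My; have E := maximizer_eq My Mea.
  have E1 : dot n y = dot n a.
    apply/eqP; rewrite eq_le Ma.2 ?leNgt /=; last exact: conv_mem.
    by apply/negP => /(H _ yV _ aV); rewrite E ltxx.
  split=> //; move: E; rewrite !dotDl !dotZl E1 => /addrI /(mulfI _); apply.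
  by rewrite gt_eqF.
split=> [Mx|[Mx Hx]].
  have En : dot n x = dot n a by apply: (face_const _ Mx) => y yV /(Vea _ yV)[].
  have Ez : dot z x = dot z a by apply: (face_const _ Mx) => y yV /(Vea _ yV)[].
  split; first by apply/(maximizerP _ Ma); split=> //; case: Mx.
  by move=> y /Mza.2; rewrite Ez.
apply/(maximizerP _ Mea); split; first by case: Mx.
rewrite !dotDl !dotZl (maximizer_eq Mx Ma); congr (_ + _ * _).
by apply/eqP; rewrite eq_le Hx // Mza.2.
Qed.

(** A face is determined by the points of [V] on it, hence by the ranking of [V]; comparing two
    normals reduces to finitely many signs. *)
Lemma maximizer_pattern V n n' :
  (forall x y, x \in V -> y \in V -> (dot n x <= dot n y) = (dot n' x <= dot n' y)) ->
  forall x, maximizer (conv V) n x <-> maximizer (conv V) n' x.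
Proof.
wlog suff W : n n' /
  (forall x y, x \in V -> y \in V -> (dot n x <= dot n y) = (dot n' x <= dot n' y)) ->
  forall x, maximizer (conv V) n x -> maximizer (conv V) n' x.
  by move=> H x; split; apply: W => // y z yV zV; rewrite H.
move=> H x Mx; have [a aV Ma] := face_mem_ex n Mx.1.
have Ma' : maximizer (conv V) n' a.
  by apply: maximizer_mem => // y yV; rewrite -H // Ma.2 //; apply: conv_mem.
apply/(maximizerP _ Ma'); split; first by case: Mx.
apply: (face_const _ Mx) => y yV My; have E := maximizer_eq My Ma.
by apply/eqP; rewrite eq_le -!H // E lexx.
Qed.

(** For a polytope and nonzero [u]: the face exposed by [n] is an edge parallel to [u], or
    equivalently [n] lies in the relative interior of the normal cone of such an edge. *)
Definition edgeat P u n :=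
  [/\ dot n u = 0,
      exists x y, [/\ maximizer P n x, maximizer P n y & x != y] &
      forall x y, maximizer P n x -> maximizer P n y -> cross (x - y) u = 0].

(** A set is parallel to [u] when each functional orthogonal to [u] is constant on it. These
    functionals are given by the vectors [cross u m], and constancy passes from [V] to the face. *)
Lemma face_parallel V n u :
  (forall x y, x \in V -> y \in V -> maximizer (conv V) n x ->
     maximizer (conv V) n y -> cross (x - y) u = 0) ->
  forall x y, maximizer (conv V) n x -> maximizer (conv V) n y -> cross (x - y) u = 0.
Proof.
move=> H x y Mx My; have [a aV Ma] := face_mem_ex n Mx.1.
have Hm m : forall z, maximizer (conv V) n z -> dot (cross u m) z = dot (cross u m) a.
  apply: face_const => z zV Mz; apply/eqP; rewrite -subr_eq0 -dotBr dot_cross_rot.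
  by rewrite H // dot0r.
(* For this [m], the squared norm of [m] is a difference of two equal values of [cross u m]. *)
set m := cross (x - y) u; apply/eqP; rewrite -dot_eq0 -/m {2}/m -dot_cross_rot.
by rewrite dotBr !Hm // subrr.
Qed.

Lemma face_two V n x y : maximizer (conv V) n x -> maximizer (conv V) n y -> x != y ->
  exists x' y', [/\ x' \in V, y' \in V, maximizer (conv V) n x',
                    maximizer (conv V) n y' & x' != y'].
Proof.
move=> Mx My; apply: contra_neqP => N; have [a aV Ma] := face_mem_ex n Mx.1.
have Hm z : maximizer (conv V) n z -> z = a.
  move=> Mz; apply/eqP; rewrite -subr_eq0 -dot_eq0 dotBr subr_eq0; apply/eqP.
  apply: (face_const _ Mz) => t tV Mt; congr (dot _ _); apply: contra_notP N => ta.
  by exists t, a; split=> //; apply/eqP.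
by rewrite (Hm x) // (Hm y).
Qed.

Lemma edgeatN P u n : edgeat P (- u) n <-> edgeat P u n.
Proof.
wlog suff W : u / edgeat P u n -> edgeat P (- u) n.
  by split=> [/W|/W //]; rewrite opprK.
move=> [h1 h2 h3]; split=> //; first by rewrite dotNr h1 oppr0.
by move=> x y Mx My; rewrite crossNr h3 ?oppr0.
Qed.

Lemma edgeat_face P u n n' : dot n' u = 0 ->
  (forall x, maximizer P n x <-> maximizer P n' x) ->
  edgeat P u n -> edgeat P u n'.
Proof.
move=> n'u H [nu [x [y [Mx My xy]]] par]; split=> //.
  by exists x, y; split=> //; apply/H.
by move=> x' y' /H Mx' /H My'; apply: par.
Qed.

End Faces.

(** * Edge directions and aggregated cones in terms of exposing normals *)

Section EdgeDirections.
Variable R : realType.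
Implicit Types (c e : R) (d m n p q r u v w x y z : vec R) (P : vec R -> Prop).
Implicit Types (V : seq (vec R)).

Lemma lin_indep2P (f : 'I_2 -> vec R) :
  lin_indep f <-> cross (f ord0) (f ord_max) != 0.
Proof.
have l1 : lift ord0 ord0 = ord_max :> 'I_2 by apply/val_inj.
have S (c : 'I_2 -> R) : \sum_i c i *: f i = c ord0 *: f ord0 + c ord_max *: f ord_max.
  by rewrite !big_ord_recl big_ord0 addr0 l1.
split=> [H|H c].
  apply/negP => /eqP E; have [q0|q0] := eqVneq (f ord_max) 0.
    have := H (fun i => (i == ord_max)%:R); rewrite S q0 /= scale0r add0r scaler0.
    by move=> /(_ erefl ord_max) /eqP; rewrite eqxx oner_eq0.
  have [c pE] := (cross_eq0P (f ord0) q0).1 E.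
  have := H (fun i => if i == ord0 then 1 else - c); rewrite S /= pE scale1r.
  by rewrite scaleNr subrr => /(_ erefl ord0) /eqP; rewrite ?eqxx oner_eq0.
rewrite S => E.
have E0 : c ord0 = 0.
  apply/eqP; have : c ord0 *: cross (f ord0) (f ord_max) == 0.
    rewrite -crossZl; move/eqP: E; rewrite addr_eq0 => /eqP ->.
    by rewrite crossNl crossZl crossvv scaler0 oppr0.
  by rewrite scaler_eq0 (negPf H) orbF.
move: E; rewrite E0 scale0r add0r => /eqP; rewrite scaler_eq0.
have -> : (f ord_max == 0) = false.
  by apply/negP => /eqP q0; move: H; rewrite q0 crossC cross0l oppr0 eqxx.
rewrite orbF => /eqP E1 i; case: (unliftP ord0 i) => [j ->|-> //].
by rewrite [j]ord1 l1.
Qed.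

(** Cramer's rule: the triple products of any [m] with two of the vectors are the coefficients of a
    combination equal to the determinant times [m]. *)
Lemma lin_indep3P (f : 'I_3 -> vec R) :
  lin_indep f <-> dot (f (inord 0)) (cross (f (inord 1)) (f (inord 2))) != 0.
Proof.
set p := f (inord 0); set q := f (inord 1); set r := f (inord 2).
have S (c : 'I_3 -> R) : \sum_i c i *: f i =
    c (inord 0) *: p + c (inord 1) *: q + c (inord 2) *: r.
  rewrite !big_ord_recl big_ord0 addr0 addrA.
  by congr (c _ *: f _ + c _ *: f _ + c _ *: f _); apply/val_inj; rewrite /= inordK.
split=> [H|H c].
  apply/negP => /eqP det0.
  have K m : dot m (cross q r) = 0.
    have := H (fun i => [:: dot m (cross q r); dot m (cross r p); dot m (cross p q)]`_i).
    rewrite S !inordK //= => /(_ _ (inord 0)); rewrite inordK //; apply.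
    transitivity (dot p (cross q r) *: m); last by rewrite det0 scale0r.
    by apply: vec_eqP; rewrite !coordE; ring.
  have qr0 : cross q r = 0 by apply/eqP; rewrite -dot_eq0 K.
  have N (s0 t : R) : s0 *: q + t *: r = 0 -> s0 = 0 /\ t = 0.
    move=> E; have := H (fun i => [:: 0; s0; t]`_i).
    rewrite S !inordK //= scale0r add0r => /(_ E) Z.
    by split; [have := Z (inord 1) | have := Z (inord 2)]; rewrite inordK.
  have [r0|r0] := eqVneq r 0.
    have [] := N 0 1; first by rewrite r0 scaler0 addr0 scale0r.
    by move=> _ /eqP; rewrite oner_eq0.
  have [c qE] := (cross_eq0P q r0).1 qr0.
  have [] := N 1 (- c); first by rewrite scale1r qE scaleNr subrr.
  by move=> /eqP; rewrite oner_eq0.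
rewrite S => E.
have K a : dot a p * c (inord 0) + dot a q * c (inord 1) + dot a r * c (inord 2) = 0.
  transitivity (dot a (c (inord 0) *: p + c (inord 1) *: q + c (inord 2) *: r)).
    by rewrite !dotDr !dotZr; ring.
  by rewrite E dot0r.
have Z (b : R) : b * dot p (cross q r) = 0 -> b = 0.
  by move/eqP; rewrite mulf_eq0 (negPf H) orbF => /eqP.
have c0 : c (inord 0) = 0.
  by apply: Z; rewrite -(K (cross q r)) !coordE; ring.
have c1 : c (inord 1) = 0.
  by apply: Z; rewrite -(K (cross r p)) !coordE; ring.
have c2 : c (inord 2) = 0.
  by apply: Z; rewrite -(K (cross p q)) !coordE; ring.
move=> i; have -> : i = inord i by rewrite inord_val.
by case: i => -[|[|[|//]]].
Qed.

Lemma ex_cross_neq0 u : u != 0 -> exists t, cross u t != 0.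
Proof.
move=> u0; apply: contra_neqP u0 => N.
have Z t : cross u t = 0 by apply: contra_notP N => /eqP; exists t.
pose t i : vec R := \row_j (j == i :> 'I_3)%:R.
have i01 : (inord 0 == inord 1 :> 'I_3) = false by rewrite -val_eqE /= !inordK.
have i02 : (inord 0 == inord 2 :> 'I_3) = false by rewrite -val_eqE /= !inordK.
have i12 : (inord 1 == inord 2 :> 'I_3) = false by rewrite -val_eqE /= !inordK.
have := Z (t (inord 0)); have := Z (t (inord 1)).
move=> /(congr1 (@cz R)) + /[dup] /(congr1 (@cy R)) + /(congr1 (@cz R)).
rewrite !coordE /t /cx /cy /cz !mxE !eqxx ?[_ == inord 0]eq_sym.
rewrite i01 i02 ?[inord 2 == _]eq_sym ?i12 ?i02 ?mulr1 ?mulr0 ?subr0 ?sub0r => h1 h2 /eqP.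
rewrite oppr_eq0 => /eqP h3.
by apply: vec_eqP; rewrite coord0 /cx /cy /cz.
Qed.

(** [z] is constant along [u], so using it to break ties does not shrink an edge parallel to [u]. *)
Lemma face_perturb_orth P n u z : dot z u = 0 -> edgeat P u n -> u != 0 ->
  forall x, maximizer (maximizer P n) z x <-> maximizer P n x.
Proof.
move=> zu [nu _ par] u0 x; split=> [[]//|Mx]; split=> // y My.
have [c E] := (cross_eq0P (y - x) u0).1 (par _ _ My Mx).
by rewrite -subr_le0 -dotBr E dotZr zu mulr0.
Qed.

(** Breaking ties by [z] selects a single point of the edge, its end farthest along [u]; that point
    is exposed by [n + e *: z] and is therefore a vertex. *)
Lemma edge_endpoint V u n z : edgeat (conv V) u n -> 0 < dot z u ->
  exists a, [/\ maximizer (conv V) n a, vertex (conv V) a &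
    forall x, maximizer (conv V) n x -> exists2 c, 0 <= c & x = a - c *: u].
Proof.
move=> He zu; have u0 : u != 0 by apply: contraTneq zu => ->; rewrite dot0r ltxx.
have [nu [x [y [Mx My xy]]] par] := He.
have [e e0 He'] := small_ex (perturb V n z).
have [a aV Ma] := face_mem_ex (n + e *: z) Mx.1.
have Mza := (He' a).1 Ma.
exists a; split=> [||t Mt]; first by case: Mza.
  exists (n + e *: z); split; first by exists a.
  move=> t; split=> [->//|/He' Mzt].
  have [c E] := (cross_eq0P (t - a) u0).1 (par _ _ Mzt.1 Mza.1).
  have : dot z (t - a) = 0.
    by rewrite dotBr (maximizer_eq Mzt Mza) subrr.
  rewrite E dotZr => /eqP; rewrite mulf_eq0 (gt_eqF zu) orbF => /eqP c0.
  by apply/eqP; rewrite -subr_eq0 E c0 scale0r.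
have [c E] := (cross_eq0P (t - a) u0).1 (par _ _ Mt Mza.1).
exists (- c); last by rewrite scaleNr opprK -E addrC subrK.
have : dot z (t - a) <= 0 by rewrite dotBr subr_le0 Mza.2.
by rewrite E dotZr pmulr_lle0 // oppr_ge0.
Qed.

(** Replaces edges, vertices and dimensions by one exposing normal. The two vertices of the edge
    come from breaking ties along [u] and along [- u]. *)
Lemma edge_dirP V u : edge_dir (conv V) u <->
  [/\ dot u u = 1, first_nonzero_pos u & exists n, edgeat (conv V) u n].
Proof.
split=> [[u1 [fu]]|[u1 fu [n He]]]; last first.
  have u0 : u != 0 by rewrite -dot_gt0 u1 ltr01.
  have uu : 0 < dot u u by rewrite dot_gt0.
  split=> //; split=> //; have [nu [x [y [Mx My xy]]] par] := He.
  have [a [Ma va Ha]] := edge_endpoint He uu.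
  have [b [Mb vb Hb]] : exists a, [/\ maximizer (conv V) n a, vertex (conv V) a &
      forall x, maximizer (conv V) n x -> exists2 c, 0 <= c & x = a - c *: (- u)].
    by apply: (@edge_endpoint V (- u) n (- u)); [apply/edgeatN|rewrite dotNl dotNr opprK].
  have [c c0 bE] := Ha _ Mb.
  exists (maximizer (conv V) n), a, b, (- c).
  split; last first.
    split=> //; split=> //; split=> //; split=> //; split; last first.
      by rewrite bE addrC addKr scaleNr.
    apply/eqP => ab; move: xy; apply/negP; rewrite negbK.
    have Z t : maximizer (conv V) n t -> t = a.
      move=> Mt; have [c1 c10 E1] := Ha _ Mt; have [c2 c20 E2] := Hb _ Mt.
      move: E2; rewrite E1 ab scalerN opprK => /addrI /eqP.
      rewrite -scaleNr -subr_eq0 -scalerBl scaler_eq0 (negPf u0) orbF => /eqP E.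
      have -> : c1 = 0 by lra.
      by rewrite oppr0 scale0r addr0.
    by rewrite (Z x) // (Z y).
  split; first by exists n; split; [exists x|].
  split; first by exists x.
  split.
    exists (fun _ => x - y); split; first by move=> _; exists x, y.
    move=> k; rewrite big_ord_recl big_ord0 addr0 => /eqP; rewrite scaler_eq0.
    by rewrite subr_eq0 (negPf xy) orbF => /eqP E i; rewrite [i]ord1.
  move=> f Hf /lin_indep2P; apply/negP; rewrite negbK.
  have K i : exists k, f i = k *: u.
    have [x' [y' [Mx' [My' ->]]]] := Hf i; apply/(cross_eq0P _ u0); exact: par.
  have [k1 ->] := K ord0; have [k2 ->] := K ord_max.
  by rewrite crossZl crossZr crossvv !scaler0.
move=> [E [a [b [c [[[n [_ En]] [_ [_ dimE]]] [_ [_ [Ea [Eb [ab bE]]]]]]]]]].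
have u0 : u != 0 by rewrite -dot_gt0 u1 ltr01.
have c0 : c != 0.
  apply: contra_neq ab => c0; apply/eqP.
  by rewrite eq_sym -subr_eq0 bE c0 scale0r.
split=> //; exists n; split.
- have : dot n (b - a) = 0.
    by rewrite dotBr (maximizer_eq ((En _).1 Eb) ((En _).1 Ea)) subrr.
  by rewrite bE dotZr => /eqP; rewrite mulf_eq0 (negPf c0) => /eqP.
- by exists a, b; split=> //; apply/En.
- move=> x y Mx My; apply/eqP; apply/negP => /negP N.
  apply: (dimE (fun i => if i == ord0 then x - y else b - a)).
    by move=> i; case: ifP => _; [exists x, y | exists b, a]; split=> //; try split=> //;
      apply/En.
  apply/lin_indep2P => /=; rewrite bE crossZr; exact: scaler_neq0.
Qed.

(** Small moves of [n] in the two independent directions [z1] and [z2] orthogonal to [u] stay in the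
    normal cone, while every normal to the edge is orthogonal to [u]. *)
Lemma normal_cone_ldim2 V u n : u != 0 -> edgeat (conv V) u n ->
  ldim (normal_cone (conv V) (maximizer (conv V) n)) 2.
Proof.
move=> u0 He; have [nu [x [y [Mx My xy]]] par] := He.
have [t ut] := ex_cross_neq0 u0.
pose z1 := cross u t; pose z2 := cross u z1.
have N z : dot z u = 0 -> small (fun e =>
    normal_cone (conv V) (maximizer (conv V) n) (n + e *: z)).
  move=> zu; apply: (small_imp _ (perturb V n z)) => e _ H x' y' Px' My'.
  have /H : maximizer (maximizer (conv V) n) z y' by apply/(face_perturb_orth zu He u0).
  by case=> _; apply.
have z1u : dot z1 u = 0 by rewrite dot_crossl.
have z2u : dot z2 u = 0 by rewrite dot_crossl.
(* Up to the factor [e], the determinant of [u] and the two moved normals is affine in [e] with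
   nonzero slope. *)
have := @small_neq0 R (dot u (cross n z2) + dot u (cross z1 n)) (dot u (cross z1 z2)).
have -> : dot u (cross z1 z2) = dot z1 z1 * dot u u.
  by rewrite /z2 /z1 !coordE; ring.
have -> : dot z1 z1 * dot u u != 0 by rewrite mulf_neq0 // dot_eq0.
move=> /(_ (fun _ => isT)) S.
have [e e0 [[N1 N2] ne]] := small_ex (small_and (small_and (N _ z1u) (N _ z2u)) S).
split.
  exists (fun i => if i == ord0 then n + e *: z1 else n + e *: z2); split.
    by move=> i; case: ifP.
  apply/lin_indep2P => /=; apply: contra_neq ne => E.
  have : dot u (cross (n + e *: z1) (n + e *: z2)) = 0 by rewrite E dot0r.
  have eB : dot u (cross z1 z2) = dot z1 z1 * dot u u.
    by rewrite /z2 /z1 !coordE; ring.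
  have -> : dot u (cross (n + e *: z1) (n + e *: z2)) =
      e * (dot u (cross n z2) + dot u (cross z1 n) + e * (dot z1 z1 * dot u u)).
    by rewrite -eB !coordE; ring.
  by move=> /eqP; rewrite mulf_eq0 gt_eqF //= => /eqP.
move=> f Nf /lin_indep3P; apply/negP; rewrite negbK.
have K i : dot (f i) u = 0.
  have [c E] := (cross_eq0P (x - y) u0).1 (par _ _ Mx My).
  have : dot (f i) (x - y) = 0.
    apply/eqP; rewrite dotBr subr_eq0 eq_le.
    by rewrite (Nf i x y Mx.1 My) (Nf i y x My.1 Mx).
  rewrite E dotZr => /eqP; rewrite mulf_eq0 => /predU1P[c0|/eqP //].
  by move: xy; rewrite -subr_eq0 E c0 scale0r eqxx.
(* Two vectors orthogonal to [u] have a cross product parallel to [u], to which [f (inord 0)] is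
   orthogonal. *)
have : dot u u *: cross (f (inord 1)) (f (inord 2)) =
       dot u (cross (f (inord 1)) (f (inord 2))) *: u.
  move: (K (inord 1)) (K (inord 2)).
  set p := f (inord 1); set q := f (inord 2) => pu qu.
  transitivity (dot u (cross p q) *: u
    + (dot p u *: cross u q - dot q u *: cross u p)); first last.
    by rewrite pu qu !scale0r subrr addr0.
  by apply: vec_eqP; rewrite !coordE; ring.
move=> /(congr1 (dot (f (inord 0)))); rewrite !dotZr K mulr0 => /eqP.
by rewrite mulf_eq0 dot_eq0 (negPf u0).
Qed.

(** The cone is the union of the normal cones of the edges parallel to [u], and [w] is normal to a
    face when the face exposed by [w] contains it. *)
Lemma agg_coneP V u w : u != 0 -> agg_cone (conv V) u w <->
  exists2 n, edgeat (conv V) u n &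
    forall x, maximizer (conv V) n x -> maximizer (conv V) w x.
Proof.
move=> u0; split=> [[F [[n [[x0 Mx0] Fn]] [[[f [Nf fi]] _] [Nu Nw]]]]|[n He sub]].
  have NF : normal_cone (conv V) F n by move=> x y Px /Fn[_]; apply.
  exists n; last first.
    by move=> x Mx; split; [case: Mx | move=> y Py; apply: Nw => //; apply/Fn].
  split; first by rewrite dotC; apply: Nu.
    apply: contrapT => N.
    have Z x : maximizer (conv V) n x -> x = x0.
      by move=> Mx; apply: contra_notP N => /eqP xx0; exists x, x0.
    (* Were the face a single point, [n + e *: u] would still be normal to it without being
       orthogonal to [u]. *)
    have [e e0 He] := small_ex (perturb V n u).
    have : orth u (n + e *: u).
      apply: Nu => x y Px /Fn /Z ->.
      suff /He[_] : maximizer (maximizer (conv V) n) u x0 by apply.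
      by split=> // t /Z ->.
    rewrite /orth dotDr dotZr (Nu _ NF) add0r => /eqP.
    by rewrite mulf_eq0 gt_eqF //= dot_eq0 (negPf u0).
  move=> x y Mx My; apply/eqP; apply/negP => /negP N.
  move/lin_indep2P: fi; apply/negP; rewrite negbK.
  (* If the face had a difference [x - y] not parallel to [u], all its normals orthogonal to [u]
     would lie on one line. *)
  have K i : exists c, f i = c *: cross (x - y) u.
    apply: orth2_parallel => //; last by rewrite dotC; apply: Nu.
    apply/eqP; rewrite dotBr subr_eq0 eq_le.
    by rewrite (Nf i x y Mx.1) ?(Nf i y x My.1) //; apply/Fn.
  have [c1 ->] := K ord0; have [c2 ->] := K ord_max.
  by rewrite crossZl crossZr crossvv !scaler0.
have [nu [x [y [Mx My xy]]] par] := He.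
exists (maximizer (conv V) n); split; first by exists n; split=> //; exists x.
split; first exact: normal_cone_ldim2 He.
split; last by move=> x' y' Px' /sub[_]; apply.
move=> m Nm; rewrite /orth dotC.
have [c E] := (cross_eq0P (x - y) u0).1 (par _ _ Mx My).
have : dot m (x - y) = 0.
  by apply/eqP; rewrite dotBr subr_eq0 eq_le (Nm x y Mx.1 My) (Nm y x My.1 Mx).
rewrite E dotZr => /eqP; rewrite mulf_eq0 => /predU1P[c0|/eqP //].
by move: xy; rewrite -subr_eq0 E c0 scale0r eqxx.
Qed.

End EdgeDirections.

(** * Generic projection directions and silhouette counts *)

Section Generic.
Variable R : realType.
Implicit Types (c e : R) (d m n p q r u v w x y z : vec R) (P : vec R -> Prop).
Implicit Types (B V : seq (vec R)).

Definition diffs B := [seq x - y | x <- B, y <- B].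

(** Excludes finitely many planes through the origin. [B] will be the concatenation of the lists of
    [P], [Q] and their sum, so that one [v] suits the three hulls. *)
Definition generic B v := forall d d', d \in diffs B -> d' \in diffs B ->
  cross d d' != 0 -> dot v (cross d d') != 0.

Definition direction B u := exists2 d, d \in diffs B & exists2 c, c != 0 & u = c *: d.

Lemma diffs_mem B x y : x \in B -> y \in B -> x - y \in diffs B.
Proof. by move=> xB yB; apply/allpairsP; exists (x, y). Qed.

Lemma diffsN B d : d \in diffs B -> - d \in diffs B.
Proof. by case/allpairsP => -[x y] [/= xB yB ->]; rewrite opprB diffs_mem. Qed.

Lemma diffs_sub V B : {subset V <= B} -> {subset diffs V <= diffs B}.
Proof. by move=> VB d /allpairsP[[x y] [/= /VB xB /VB yB ->]]; apply: diffs_mem. Qed.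

Lemma diffs_direction B d : d \in diffs B -> direction B d.
Proof. by move=> dB; exists d => //; exists 1; rewrite ?oner_eq0 // scale1r. Qed.

Lemma directionN B u : direction B u -> direction B (- u).
Proof.
by case=> d dB [c c0 ->]; exists d => //; exists (- c); rewrite ?oppr_eq0 // scaleNr.
Qed.

Lemma direction_sub V B u : {subset V <= B} -> direction V u -> direction B u.
Proof. by move=> VB [d /(diffs_sub VB) dB uE]; exists d. Qed.

Lemma generic_direction B v u u' : generic B v -> direction B u -> direction B u' ->
  cross u u' != 0 -> dot v (cross u u') != 0.
Proof.
move=> gv [d dB [c c0 ->]] [d' d'B [c' c'0 ->]].
rewrite crossZl crossZr !scaler_eq0 !negb_or => /and3P[_ _ dd'].
by rewrite !dotZr !mulf_neq0 // gv.
Qed.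

Lemma genericN B v : generic B v -> generic B (- v).
Proof. by move=> gv d d' dB d'B h; rewrite dotNl oppr_eq0 gv. Qed.

(** Each condition is affine in [e], with a slope that is nonzero because [z] is generic; so generic
    vectors occur arbitrarily close to any [u]. *)
Lemma generic_perturb B u z : generic B z -> small (fun e => generic B (u + e *: z)).
Proof.
move=> gz; have : small (fun e => forall d, d \in diffs B -> forall d', d' \in diffs B ->
    cross d d' != 0 -> dot (u + e *: z) (cross d d') != 0).
  apply: small_all => d dB; apply: small_all => d' d'B.
  have [->|h] := eqVneq (cross d d') 0; first by apply: small_pos.
  have : small (fun e => dot u (cross d d') + e * dot z (cross d d') != 0).
    by apply: small_neq0 => _; apply: gz.
  by apply: small_imp => e _ H _; rewrite dotDl dotZl.
by apply: small_imp => e _ H d d' dB d'B; apply: H.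
Qed.

(** Planes are avoided one at a time: a small move along the normal [m] of a new plane ends outside
    that plane and stays off the earlier ones. *)
Lemma generic_ex B : exists v, generic B v.
Proof.
suff [v Hv] : exists v, forall m, m \in [seq cross d d' | d <- diffs B, d' <- diffs B] ->
    m != 0 -> dot v m != 0.
  by exists v => d d' dB d'B; apply: Hv; apply/allpairsP; exists (d, d').
elim: [seq _ | d <- _, d' <- _] => [|m s [v Hv]]; first by exists 0.
have [m0|m0] := eqVneq m 0.
  by exists v => m'; rewrite inE => /predU1P[->|/Hv //]; rewrite m0 eqxx.
have S : small (fun e => forall m', m' \in m :: s -> m' != 0 -> dot (v + e *: m) m' != 0).
  apply: small_all => m' m's; have [->|m'0] := eqVneq m' 0; first exact: small_pos.
  have : small (fun e => dot v m' + e * dot m m' != 0).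
    apply: small_neq0 => vm'; move: m's; rewrite inE => /predU1P[->|/Hv].
      by rewrite dot_eq0.
    by rewrite vm' eqxx => /(_ m'0).
  by apply: small_imp => e _ H _; rewrite dotDl dotZl.
by have [e _ He] := small_ex S; exists (v + e *: m).
Qed.

Lemma edge_direction V u n : u != 0 -> edgeat (conv V) u n -> direction V u.
Proof.
move=> u0 [nu [x [y [Mx My xy]]] par].
have [x' [y' [x'V y'V Mx' My' x'y']]] := face_two Mx My xy.
have [c E] := (cross_eq0P (x' - y') u0).1 (par _ _ Mx' My').
have c0 : c != 0 by apply: contra_neq x'y' => c0; apply/eqP; rewrite -subr_eq0 E c0 scale0r.
exists (x' - y'); first exact: diffs_mem.
by exists c^-1; [rewrite invr_eq0 | rewrite E scalerA mulVf // scale1r].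
Qed.

(** Two points of [V] on the face differ by a vector orthogonal to [cross u v]; a generic [v] allows
    this only if the difference is parallel to [u]. *)
Lemma generic_parallel B V u v : generic B v -> {subset V <= B} -> direction B u ->
  forall x y, maximizer (conv V) (cross u v) x -> maximizer (conv V) (cross u v) y ->
  cross (x - y) u = 0.
Proof.
move=> gv VB uB; apply: face_parallel => x y xV yV Mx My.
apply/eqP/negP => /negP N.
have : dot v (cross (x - y) u) != 0.
  by apply: generic_direction gv _ uB N; apply/diffs_direction/diffs_mem; apply: VB.
by rewrite -dot_cross_rot dotBr (maximizer_eq Mx My) subrr eqxx.
Qed.

(** For [u] and [v] not parallel, [cross u v] and [cross (- u) v] span the two rays orthogonal to
    both; each can expose one edge parallel to [u] on the silhouette seen along [v]. *)
Definition edge_ind P u v : bool := `[< edgeat P u (cross u v) >].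

Definition edge_count P u v : nat := (edge_ind P u v + edge_ind P (- u) v)%N.

Lemma agg_coneN V u w : u != 0 -> agg_cone (conv V) (- u) w <-> agg_cone (conv V) u w.
Proof.
move=> u0; have Nu0 : - u != 0 by rewrite oppr_eq0.
by split=> /agg_coneP-/(_ ltac:(assumption))[n /edgeatN He sub]; apply/agg_coneP => //; exists n.
Qed.

(** A ray of the cone exposes a face containing an edge parallel to [u]; genericity excludes
    anything larger. *)
Lemma edge_ind_agg B V u v : generic B v -> {subset V <= B} -> direction B u -> u != 0 ->
  edge_ind (conv V) u v <-> agg_cone (conv V) u (cross u v).
Proof.
move=> gv VB uB u0; split=> [/asboolP He|/agg_coneP-/(_ u0)[n He sub]].
  by apply/agg_coneP => //; exists (cross u v).
apply/asboolP; split; first by rewrite dot_crossl.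
  by have [_ [x [y [Mx My xy]]] _] := He; exists x, y; split=> //; apply: sub.
exact: generic_parallel gv VB uB.
Qed.

Lemma edge_indN_agg B V u v : generic B v -> {subset V <= B} -> direction B u -> u != 0 ->
  edge_ind (conv V) (- u) v <-> agg_cone (conv V) u (cross (- u) v).
Proof.
move=> gv VB uB u0; rewrite -(agg_coneN _ _ u0).
by apply: (edge_ind_agg gv VB); [apply: directionN | rewrite oppr_eq0].
Qed.

(** Projection vectors near [cross n u] give normals near [n], so an edge exposed by an arbitrary
    normal becomes visible on the silhouette along a generic vector. *)
Lemma cross_approach n u e z : dot u u = 1 -> dot n u = 0 ->
  cross u (cross n u + e *: z) = n + e *: cross u z.
Proof. by move=> u1 nu; rewrite crossDr crossZr cross_cross_orth // u1 scale1r. Qed.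

Lemma edge_approach V u n z : dot u u = 1 -> edgeat (conv V) u n ->
  small (fun e => edge_ind (conv V) u (cross n u + e *: z) /\
    forall x, maximizer (conv V) (cross u (cross n u + e *: z)) x <->
              maximizer (conv V) n x).
Proof.
move=> u1 He; have u0 : u != 0 by rewrite -dot_gt0 u1 ltr01.
apply: (small_imp _ (perturb V n (cross u z))) => e _ H.
have [nu _ _] := He.
have E x : maximizer (conv V) n x <->
    maximizer (conv V) (cross u (cross n u + e *: z)) x.
  rewrite cross_approach //; split=> [Mx|/H[]//].
  by apply/H/(face_perturb_orth _ He u0) => //; rewrite dot_crossl.
split; last by move=> x; split=> /E.
by apply/asboolP; apply: edgeat_face E He; rewrite dot_crossl.
Qed.

Lemma agg_cone_orth P u w : agg_cone P u w -> orth u w.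
Proof. by move=> [F [_ [_ [Nu Nw]]]]; apply: Nu. Qed.

(** Closedness of the cone: a normal close to [w] exposes a face contained in the face exposed by
    [w]. *)
Lemma agg_cone_limit V u w : dot u u = 1 -> dot w u = 0 ->
  forall z, small (fun e => edge_ind (conv V) u (cross w u + e *: z) ->
                            agg_cone (conv V) u w).
Proof.
move=> u1 wu z; have u0 : u != 0 by rewrite -dot_gt0 u1 ltr01.
apply: (small_imp _ (perturb V w (cross u z))) => e _ H /asboolP He.
apply/agg_coneP => //; exists (cross u (cross w u + e *: z)) => // x.
by rewrite cross_approach // => /H[].
Qed.

(** Generic rays are dense in the plane orthogonal to [u] and the cone is closed, so it is enough to
    test generic rays. *)
Lemma cfullP B V u : {subset V <= B} -> direction B u -> dot u u = 1 ->
  cfull (conv V) u <-> forall v, generic B v -> edge_ind (conv V) u v.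
Proof.
move=> VB uB u1; have u0 : u != 0 by rewrite -dot_gt0 u1 ltr01.
split=> [fu v gv|H w].
  by apply/(edge_ind_agg gv VB uB u0)/fu; rewrite /orth dotC dot_crossl.
split=> [|uw]; first exact: agg_cone_orth.
have wu : dot w u = 0 by rewrite dotC.
have [z gz] := generic_ex B.
have [e _ [h1 h2]] := small_ex (small_and (agg_cone_limit V u1 wu z)
  (generic_perturb (cross w u) gz)).
exact/h1/H.
Qed.

(** An edge parallel to [u] makes the count positive at some generic vector, hence at all of them;
    if the count is always [2], all generic rays are in the cone and the cone is full. *)
Lemma edge_count_mult B V u v : {subset V <= B} -> edge_dir (conv V) u ->
  (forall v v', generic B v -> generic B v' ->
     edge_count (conv V) u v = edge_count (conv V) u v') ->
  generic B v -> edge_count (conv V) u v = mult (conv V) u.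
Proof.
move=> VB /edge_dirP[u1 _ [n He]] cst gv.
have u0 : u != 0 by rewrite -dot_gt0 u1 ltr01.
have uB : direction B u by apply: direction_sub VB (edge_direction u0 He).
have ge1 : (0 < edge_count (conv V) u v)%N.
  have [e _ [[h1 _] h2]] := small_ex (small_and (edge_approach v u1 He)
    (generic_perturb (cross n u) gv)).
  by rewrite (cst _ _ gv h2) /edge_count h1.
have le2 : (edge_count (conv V) u v <= 2)%N.
  by rewrite /edge_count; do 2!case: edge_ind.
rewrite /mult; case: asboolP => [fu|nfu].
  have h1 : edge_ind (conv V) u v by apply: (cfullP VB uB u1).1.
  have h2 : edge_ind (conv V) (- u) v.
    apply/(edge_indN_agg gv VB uB u0)/fu.
    by rewrite /orth crossNl dotNr dotC dot_crossl oppr0.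
  by rewrite /edge_count h1 h2.
apply/eqP; rewrite eqn_leq ge1 andbT -ltnS ltn_neqAle le2 andbT.
apply/negP => /eqP E2; apply/nfu/(cfullP VB uB u1) => v' gv'.
by move: E2; rewrite (cst _ _ gv gv') /edge_count; case: edge_ind; case: edge_ind.
Qed.

Lemma edge_ind_pattern V u v v' :
  (forall d, d \in diffs V ->
     (0 <= dot (cross u v) d) = (0 <= dot (cross u v') d)) ->
  edge_ind (conv V) u v = edge_ind (conv V) u v'.
Proof.
move=> H; have E x : maximizer (conv V) (cross u v) x <-> maximizer (conv V) (cross u v') x.
  apply: maximizer_pattern => a b aV bV.
  rewrite -subr_ge0 -dotBr H; last exact: diffs_mem.
  by rewrite dotBr subr_ge0.
by apply/asboolP/asboolP; apply: edgeat_face; rewrite ?dot_crossl // => x; split=> /E.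
Qed.

Lemma edge_count_pattern V u v v' :
  (forall d, d \in diffs V ->
     (0 <= dot (cross u v) d) = (0 <= dot (cross u v') d)) ->
  edge_count (conv V) u v = edge_count (conv V) u v'.
Proof.
move=> H; rewrite /edge_count (edge_ind_pattern H); congr (_ + nat_of_bool _)%N.
apply: edge_ind_pattern => d dV.
by rewrite !crossNl !dotNl -!dotNr; apply/H/diffsN.
Qed.

Lemma edge_countN P u v : edge_count P u (- v) = edge_count P u v.
Proof.
rewrite /edge_count addnC; congr (nat_of_bool _ + nat_of_bool _)%N.
  by rewrite /edge_ind crossNl crossNr opprK; apply: asbool_equiv_eq; apply: edgeatN.
rewrite /edge_ind crossNl crossNr; apply: asbool_equiv_eq.
by split=> /edgeatN.
Qed.

Lemma edge_countZ V u v c : 0 < c -> edge_count (conv V) u (c *: v) = edge_count (conv V) u v.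
Proof.
by move=> c0; apply: edge_count_pattern => d _; rewrite crossZr dotZl pmulr_rge0.
Qed.

Lemma same_sign (a b c : R) : 0 < a * b -> (0 <= c * a) = (0 <= c * b).
Proof.
move=> ab; have [a0|a0|a0] := ltgtP a 0; last by rewrite a0 mul0r ltxx in ab.
  have b0 : b < 0 by nra.
  by rewrite !nmulr_lge0.
have b0 : 0 < b by nra.
by rewrite !pmulr_lge0.
Qed.

(** The signs that determine the faces depend on [v] only through the sign of [dot v m], and
    replacing [v] by [- v] merely swaps the two rays. *)
Lemma edge_count_coplanar V u v v' m :
  (forall d, d \in diffs V -> exists c, cross d u = c *: m) ->
  dot v m != 0 -> dot v' m != 0 -> edge_count (conv V) u v = edge_count (conv V) u v'.
Proof.
move=> H.
wlog : v' / 0 < dot v m * dot v' m.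
  move=> W vm v'm; have := mulf_neq0 vm v'm; rewrite neq_lt => /orP[lt0|gt0].
    by rewrite -(edge_countN _ _ v'); apply: W; rewrite // dotNl ?oppr_eq0 // mulrN oppr_gt0.
  exact: W.
move=> s _ _; apply: edge_count_pattern => d dV; have [c E] := H d dV.
by rewrite !dot_cross_rot E !dotZr; apply: same_sign.
Qed.

(** As [e] tends to [0] the normal tends to [m], so differences not orthogonal to [m] keep their
    sign. The others are coplanar with [u] and [u0], and their signs depend only on the side of that
    plane on which [v] lies. *)
Lemma edge_count_cross V u u0 v v' : cross u u0 != 0 ->
  0 < dot v (cross u u0) * dot v' (cross u u0) ->
  small (fun e => edge_count (conv V) u (u0 + e *: v) = edge_count (conv V) u (u0 + e *: v')).
Proof.
set m := cross u u0 => m0 s.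
have : small (fun e => forall d, d \in diffs V ->
    (0 <= dot (cross u (u0 + e *: v)) d) = (0 <= dot (cross u (u0 + e *: v')) d)).
  apply: small_all => d dV.
  have D (a : vec R) e : dot (cross u (u0 + e *: a)) d = dot m d + e * dot (cross u a) d.
    by rewrite crossDr crossZr dotDl dotZl.
  have [md|md|md] := ltgtP (dot m d) 0.
  - have md' : 0 < - dot m d by rewrite oppr_gt0.
    have := small_and (small_gt0 (- dot (cross u v) d) md')
      (small_gt0 (- dot (cross u v') d) md').
    apply: small_imp => e _ [h1 h2]; rewrite !D.
    have /lt_geF -> : dot m d + e * dot (cross u v) d < 0 by lra.
    by have /lt_geF -> : dot m d + e * dot (cross u v') d < 0 by lra.
  - have := small_and (small_gt0 (dot (cross u v) d) md) (small_gt0 (dot (cross u v') d) md).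
    by apply: small_imp => e _ [/ltW h1 /ltW h2]; rewrite !D h1 h2.
  - have [c E] : exists c, cross d u = c *: m by apply: coplanar_cross; rewrite // dotC.
    apply: small_pos => e e0; rewrite !D md !add0r !dot_cross_rot E !dotZr.
    by rewrite !(pmulr_rge0 _ e0); apply: same_sign.
by apply: small_imp => e _; apply: edge_count_pattern.
Qed.

Lemma first_nonzero_posN u : first_nonzero_pos u -> ~ first_nonzero_pos (- u).
Proof.
rewrite /first_nonzero_pos -!/(cx _) -!/(cy _) -!/(cz _) !coordE.
by move=> [?|[[? ?]|[? [? ?]]]] [?|[[? ?]|[? [? ?]]]]; lra.
Qed.

Lemma first_nonzero_pos_total u : u != 0 -> first_nonzero_pos u \/ first_nonzero_pos (- u).
Proof.
rewrite /first_nonzero_pos -!/(cx _) -!/(cy _) -!/(cz _) !coordE => u0.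
have [x0|x0|x0] := ltgtP (cx u) 0; [right; left; lra | by left; left |].
have [y0|y0|y0] := ltgtP (cy u) 0; [right; right; left; lra | by left; right; left |].
have [z0|z0|z0] := ltgtP (cz u) 0; [right; right; right; lra | by left; right; right |].
by move: u0; rewrite (_ : u = 0) ?eqxx //; apply: vec_eqP; rewrite coord0.
Qed.

Lemma unit_parallel u u0 : dot u u = 1 -> dot u0 u0 = 1 -> cross u u0 = 0 ->
  u = u0 \/ u = - u0.
Proof.
move=> u1 u01 h; have u00 : u0 != 0 by rewrite -dot_gt0 u01 ltr01.
have [c E] := (cross_eq0P u u00).1 h.
move: u1; rewrite E dotZl dotZr u01 mulr1 => /eqP; rewrite -expr2 sqrf_eq1.
by case/orP => /eqP ->; [left; rewrite scale1r | right; rewrite scaleN1r].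
Qed.

Lemma edge_dir_cross V V' u u0 : edge_dir (conv V) u -> edge_dir (conv V') u0 -> u != u0 ->
  cross u u0 != 0.
Proof.
move=> [u1 [fu _]] [u01 [fu0 _]]; apply: contra_neq => h.
have [//|E] := unit_parallel u1 u01 h.
by rewrite E in fu; have := first_nonzero_posN fu0.
Qed.

(* Approaching [u0] along [v] and along [- v], the count of any other direction [u] is
   seen once from each side of the plane spanned by [u] and [u0]. *)
Lemma edge_count_const B V (s : seq (vec R)) k : {subset V <= B} -> uniq s ->
  (forall u, u \in s <-> edge_dir (conv V) u) ->
  (forall v, generic B v -> k = (\sum_(u <- s) edge_count (conv V) u v)%N) ->
  forall u v v', edge_dir (conv V) u -> generic B v -> generic B v' ->
    edge_count (conv V) u v = edge_count (conv V) u v'.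
Proof.
move=> VB us sE Hk u0 v v' du0 gv gv'.
have u0s : u0 \in s by apply/sE.
have dir u : u \in s -> direction B u.
  move=> /sE/edge_dirP[u1 _ [n He]]; apply: direction_sub VB (edge_direction _ He).
  by rewrite -dot_gt0 u1 ltr01.
have S : small (fun e => forall u, u \in s -> u != u0 ->
   (edge_count (conv V) u (u0 + e *: v)%R + edge_count (conv V) u (u0 + e *: - v)%R =
    edge_count (conv V) u (u0 + e *: v')%R + edge_count (conv V) u (u0 + e *: - v')%R)%N).
  apply: small_all => u us'; have [->|uu0] := eqVneq u u0; first exact: small_pos.
  have m0 := edge_dir_cross ((sE u).1 us') du0 uu0.
  have vm : dot v (cross u u0) != 0 by apply: (generic_direction gv) => //; apply: dir.
  have v'm : dot v' (cross u u0) != 0 by apply: (generic_direction gv') => //; apply: dir.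
  (* [v] is paired with [- v'] if [v] and [v'] lie on opposite sides of the plane, and with [v']
     otherwise. *)
  have := mulf_neq0 vm v'm; rewrite neq_lt => /orP[lt0|gt0].
    have h1 : 0 < dot v (cross u u0) * dot (- v') (cross u u0) by rewrite dotNl; nra.
    have h2 : 0 < dot (- v) (cross u u0) * dot v' (cross u u0) by rewrite dotNl; nra.
    have := small_and (edge_count_cross V m0 h1) (edge_count_cross V m0 h2).
    by apply: small_imp => e _ [-> ->]; rewrite addnC.
  have h2 : 0 < dot (- v) (cross u u0) * dot (- v') (cross u u0) by rewrite !dotNl; nra.
  have := small_and (edge_count_cross V m0 gt0) (edge_count_cross V m0 h2).
  by apply: small_imp => e _ [-> ->].
have [e e0 [[He g1] [g2 [g3 g4]]]] := small_ex (small_and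
  (small_and S (generic_perturb u0 gv)) (small_and (generic_perturb u0 (genericN gv))
  (small_and (generic_perturb u0 gv') (generic_perturb u0 (genericN gv'))))).
(* [cross u0 _] kills the component along [u0]. *)
have E0 (a : vec R) : edge_count (conv V) u0 (u0 + e *: a) = edge_count (conv V) u0 a.
  rewrite -(edge_countZ V u0 a e0); apply: edge_count_pattern => d _.
  by rewrite crossDr crossvv add0r.
have T : (\sum_(u <- s) (edge_count (conv V) u (u0 + e *: v)%R +
                        edge_count (conv V) u (u0 + e *: - v)%R) =
         \sum_(u <- s) (edge_count (conv V) u (u0 + e *: v')%R +
                        edge_count (conv V) u (u0 + e *: - v')%R))%N.
  by transitivity (k + k)%N; [symmetry|]; rewrite big_split; congr addn; apply: Hk.
(* Once the other directions cancel, each side is twice the count of [u0], since opposite vectors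
   give equal counts. *)
move: T; rewrite !(bigD1_seq u0) //= !E0 !edge_countN.
rewrite big_seq_cond [in RHS]big_seq_cond.
rewrite (eq_bigr _ (fun u h => He u (andP h).1 (andP h).2)).
by move/addIn; rewrite !addnn => /double_inj.
Qed.

End Generic.

(** * Vertices of a generic projection *)

Section Counting.
Variable R : realType.
Implicit Types (c e : R) (d m n p q r u v w x y z : vec R) (P : vec R -> Prop).
Implicit Types (B V : seq (vec R)).

Definition normalize d : vec R := (Num.sqrt (dot d d))^-1 *: d.

Lemma normalize_gt0 d : d != 0 -> 0 < (Num.sqrt (dot d d))^-1.
Proof. by move=> d0; rewrite invr_gt0 sqrtr_gt0 dot_gt0. Qed.

Lemma dot_normalize d : d != 0 -> dot (normalize d) (normalize d) = 1.
Proof.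
move=> d0; rewrite dotZl dotZr mulrA -expr2 exprVn sqr_sqrtr ?dot_ge0 //.
by rewrite mulVf // dot_eq0.
Qed.

Lemma direction_normalize V u : dot u u = 1 -> direction V u ->
  exists2 d, d \in diffs V & u = normalize d.
Proof.
move=> u1 [d dV [c c0 uE]].
wlog c_gt0 : d c dV c0 uE / 0 < c.
  move=> W; have [c_lt0|//|/eqP] := ltgtP c 0; last by rewrite (negPf c0).
    apply: (W (- d) (- c)); rewrite ?oppr_eq0 ?oppr_gt0 //; first exact: diffsN.
    by rewrite scalerN scaleNr opprK.
  exact: (W d c).
exists d => //; rewrite /normalize uE; congr (_ *: d).
have -> : dot d d = (c^-1) ^+ 2.
  move: u1; rewrite uE dotZl dotZr => h.
  have c0' := gt_eqF c_gt0; rewrite exprVn; apply: (mulfI (x := c ^+ 2)).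
    by rewrite expf_neq0.
  by rewrite mulfV ?expf_neq0 // -[RHS]h; ring.
by rewrite sqrtr_sqr gtr0_norm ?invr_gt0 // invrK.
Qed.

Lemma edge_dirs_ex V : exists s : seq (vec R), uniq s /\
  forall u, u \in s <-> edge_dir (conv V) u.
Proof.
exists (undup [seq u <- map normalize (diffs V) | `[< edge_dir (conv V) u >]]).
split=> [|u]; first exact: undup_uniq.
rewrite mem_undup mem_filter; split=> [/andP[/asboolP //]|du].
apply/andP; split; first exact/asboolP.
move/edge_dirP: du => [u1 _ [n He]].
have u0 : u != 0 by rewrite -dot_gt0 u1 ltr01.
have [d dV ->] := direction_normalize u1 (edge_direction u0 He).
exact: map_f.
Qed.

Definition noncollinear V := forall u, u != 0 -> exists2 d, d \in diffs V & cross d u != 0.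

Lemma conv_parallel V u : (forall d, d \in diffs V -> cross d u = 0) ->
  forall x y, conv V x -> conv V y -> cross (x - y) u = 0.
Proof.
move=> H x y /maximizer0 Mx /maximizer0 My.
by apply: face_parallel Mx My => x' y' x'V y'V _ _; apply/H/diffs_mem.
Qed.

Lemma noncollinearP V u : noncollinear V -> u != 0 ->
  ~ (forall x y, conv V x -> conv V y -> cross (x - y) u = 0).
Proof.
move=> nc u0 H; have [d /allpairsP[[x y] [/= xV yV ->]]] := nc u u0.
by rewrite H ?eqxx //; apply: conv_mem.
Qed.

Lemma adim3_noncollinear V : adim (conv V) 3 -> noncollinear V.
Proof.
move=> [_ [[f [Hf /lin_indep3P fi]] _]] u u0; apply: contrapT => N.
have Z d : d \in diffs V -> cross d u = 0.
  by move=> dV; apply: contra_notP N => /eqP; exists d.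
have K i : exists c, f i = c *: u.
  have [x [y [Px [Py ->]]]] := Hf i; apply/(cross_eq0P _ u0).
  exact: conv_parallel Z _ _ Px Py.
move: fi; have [c0 ->] := K (inord 0); have [c1 ->] := K (inord 1).
by have [c2 ->] := K (inord 2); rewrite crossZl !crossZr crossvv !scaler0 dot0r eqxx.
Qed.

Lemma noncollinear_neq0 V v : noncollinear V -> generic V v -> v != 0.
Proof.
move=> nc gv; have i0 : (const_mx 1 : vec R) != 0.
  by apply/negP => /eqP/rowP/(_ ord0)/eqP; rewrite !mxE oner_eq0.
have [d dV] := nc _ i0; have [->|d0 _] := eqVneq d 0; first by rewrite cross0l eqxx.
have [d' d'V h] := nc _ d0; have := gv _ _ d'V dV h.
by apply: contraNneq => ->; rewrite dot0l.
Qed.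

Lemma generic_sub V B v : {subset V <= B} -> generic B v -> generic V v.
Proof. by move=> VB gv d d' dV d'V; apply: gv; apply: diffs_sub VB _ _. Qed.

(** A normal of a facet is a multiple of the cross product of two independent differences of points
    of [V], to which a generic [v] is not orthogonal. This supplies the side condition in the
    definition of equiprojectivity. *)
Lemma generic_facet V v : generic V v -> forall F n, facet (conv V) F ->
  normal_cone (conv V) F n -> n != 0 -> dot v n <> 0.
Proof.
move=> gv F n [[n0 [[x0 Mx0] Fn]] [_ [[f [Hf /lin_indep2P fi]] _]]] Nn nn0 vn.
have [a aV Ma] := face_mem_ex n0 Mx0.1.
have [x [y [x' [y' [[xV yV x'V y'V] [[Mx My] [[Mx' My'] h]]]]]]] :
    exists x y x' y',
    [/\ x \in V, y \in V, x' \in V & y' \in V] /\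
    (maximizer (conv V) n0 x /\ maximizer (conv V) n0 y) /\
    (maximizer (conv V) n0 x' /\ maximizer (conv V) n0 y') /\ cross (x - y) (x' - y') != 0.
  apply: contrapT => N.
  have Z x y x' y' : x \in V -> y \in V -> x' \in V -> y' \in V ->
      maximizer (conv V) n0 x -> maximizer (conv V) n0 y ->
      maximizer (conv V) n0 x' -> maximizer (conv V) n0 y' ->
      cross (x - y) (x' - y') = 0.
    move=> *; apply: contra_notP N => /eqP h.
    by exists x, y, x', y'.
  (* Parallelism is carried over from [V] to the whole facet, one pair of points at a time. *)
  have Z2 x y x' y' : x' \in V -> y' \in V ->
      maximizer (conv V) n0 x -> maximizer (conv V) n0 y ->
      maximizer (conv V) n0 x' -> maximizer (conv V) n0 y' ->
      cross (x - y) (x' - y') = 0.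
    move=> x'V y'V Mx My Mx' My'; apply: face_parallel Mx My => p q pV qV Mp Mq.
    exact: Z.
  have Z3 x y x' y' :
      maximizer (conv V) n0 x -> maximizer (conv V) n0 y ->
      maximizer (conv V) n0 x' -> maximizer (conv V) n0 y' ->
      cross (x - y) (x' - y') = 0.
    move=> Mx My Mx' My'; rewrite crossC; apply/eqP; rewrite oppr_eq0; apply/eqP.
    apply: face_parallel Mx' My' => p q pV qV Mp Mq.
    by rewrite crossC Z2 ?oppr0.
  have [x [y [/Fn Mx [/Fn My E]]]] := Hf ord0.
  have [x' [y' [/Fn Mx' [/Fn My' E']]]] := Hf ord_max.
  by move: fi; rewrite E E' Z3 ?eqxx.
have N0 p q : maximizer (conv V) n0 p -> maximizer (conv V) n0 q -> dot n (p - q) = 0.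
  move=> Mp Mq; apply/eqP; rewrite dotBr subr_eq0 eq_le.
  by rewrite (Nn _ _ Mp.1 ((Fn _).2 Mq)) (Nn _ _ Mq.1 ((Fn _).2 Mp)).
have [c E] := orth2_parallel h (N0 _ _ Mx My) (N0 _ _ Mx' My').
have := gv _ _ (diffs_mem xV yV) (diffs_mem x'V y'V) h; apply/negP; rewrite negbK.
move: vn; rewrite E dotZr => /eqP; rewrite mulf_eq0 => /orP[/eqP c0|//].
by move: nn0; rewrite E c0 scale0r eqxx.
Qed.

Lemma proj_dot v w x : dot w (proj v x) = dot (proj v w) x.
Proof. by rewrite /proj dotDr dotNr dotZr dotDl dotNl dotZl (dotC v x) (dotC w v); ring. Qed.

Lemma proj_orth v w : v != 0 -> dot (proj v w) v = 0.
Proof.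
by move=> v0; rewrite /proj dotDl dotNl dotZl mulfVK ?dot_eq0 // subrr.
Qed.

Lemma proj_id v w : dot w v = 0 -> proj v w = w.
Proof. by move=> h; rewrite /proj h mul0r scale0r subr0. Qed.

Lemma projD v w e x : proj v (w + e *: x) = proj v w + e *: proj v x.
Proof. by rewrite /proj dotDl dotZl; apply: vec_eqP; rewrite !coordE; ring. Qed.

Lemma proj_eqP v x y : v != 0 -> proj v x = proj v y <-> cross (x - y) v = 0.
Proof.
move=> v0; split=> [h|/(cross_eq0P _ v0)[c E]].
  apply/(cross_eq0P _ v0); exists (dot x v / dot v v - dot y v / dot v v).
  apply/eqP; rewrite -subr_eq0 scalerBl; apply/eqP.
  transitivity (proj v x - proj v y); last by rewrite h subrr.
  by rewrite /proj; apply: vec_eqP; rewrite !coordE; ring.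
have -> : x = y + c *: v by rewrite -E addrC subrK.
rewrite projD; have -> : proj v v = 0; last by rewrite scaler0 addr0.
by rewrite /proj mulfV ?dot_eq0 // scale1r subrr.
Qed.

(** [proj v] is self-adjoint, so maximizing [w] on the projection means maximizing [proj v w] on
    [P]. *)
Lemma maximizer_proj P v w y : maximizer (proj_set v P) w y <->
  exists2 x, y = proj v x & maximizer P (proj v w) x.
Proof.
split=> [[[x [Px ->]] H]|[x -> [Px H]]].
  by exists x => //; split=> // t Pt; rewrite -!proj_dot; apply: H; exists t.
by split=> [|_ [t [Pt ->]]]; [exists x | rewrite !proj_dot; apply: H].
Qed.

Lemma generic_cross_neq0 V u v : noncollinear V -> generic V v -> direction V u ->
  u != 0 -> cross u v != 0.
Proof.
move=> nc gv uV u0; have [d dV h] := nc _ u0.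
have := generic_direction gv (diffs_direction dV) uV h.
by rewrite -dot_cross_rot; apply: contraNneq => ->; rewrite dot0l.
Qed.

(** Oriented by [u], the silhouette edge has its head at [a]. As its outer normal is [cross u v],
    these orientations run consistently around the projected polygon, and each vertex is the head of
    exactly one edge. *)
Definition edge_top V v u a := maximizer (conv V) (cross u v) a /\
  forall x, maximizer (conv V) (cross u v) x -> exists2 c, 0 <= c & x = a - c *: u.

(** Tilting the normal slightly towards [u] singles out the head of the edge. *)
Lemma edge_top_vertex V u v a : v != 0 -> cross u v != 0 -> edge_top V v u a ->
  vertex (proj_set v (conv V)) (proj v a).
Proof.
move=> v0 uv0 [Ma Ha].
have pu : 0 < dot (proj v u) u.
  have -> : dot (proj v u) u = dot (proj v u) (proj v u).
    by rewrite [RHS]proj_dot [proj v (proj v u)]proj_id // proj_orth.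
  rewrite dot_gt0; apply: contraNneq uv0 => h.
  have -> : u = u - 0 by rewrite subr0.
  by apply/eqP/(proj_eqP _ _ v0); rewrite h proj_id // dot0l.
have [e e0 He] := small_ex (perturb V (cross u v) (proj v u)).
exists (cross u v + e *: u).
have E x : maximizer (conv V) (proj v (cross u v + e *: u)) x <-> x = a.
  rewrite projD proj_id ?dot_crossr // He; split=> [[Mx Hx]|->].
    have [c c0 xE] := Ha _ Mx; have := Hx _ Ma.
    rewrite xE dotDr dotNr dotZr => h.
    have -> : c = 0 by nra.
    by rewrite scale0r subr0.
  split=> // x' /Ha[c c0 ->]; rewrite dotDr dotNr dotZr.
  by rewrite gerDl oppr_le0 mulr_ge0 // ltW.
split; first by exists (proj v a); apply/maximizer_proj; exists a => //; apply/E.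
move=> y; split=> [->|/maximizer_proj[x -> /E -> //]].
by apply/maximizer_proj; exists a => //; apply/E.
Qed.

Lemma edge_top_bottom V u v a : edgeat (conv V) u (cross u v) -> edge_top V v u a ->
  exists2 c, 0 < c & maximizer (conv V) (cross u v) (a - c *: u).
Proof.
move=> [_ [x [y [Mx My xy]]] _] [Ma Ha].
have [c1 c10 E1] := Ha _ Mx; have [c2 c20 E2] := Ha _ My.
have [c1_0|c1_0] := eqVneq c1 0; last first.
  by exists c1; [rewrite lt_neqAle eq_sym c1_0 | rewrite -E1].
exists c2; last by rewrite -E2.
rewrite lt_neqAle eq_sym c20 andbT; apply: contra_neq xy => c2_0.
by rewrite E1 E2 c1_0 c2_0.
Qed.

(** If two edges share a projected head, testing each normal on the other edge makes two opposite
    numbers nonnegative, hence zero, and the edges are parallel. Opposite orientations would then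
    squeeze the whole hull into one edge. *)
Lemma edge_top_inj V v u1 u2 a1 a2 : noncollinear V -> generic V v ->
  dot u1 u1 = 1 -> dot u2 u2 = 1 ->
  edgeat (conv V) u1 (cross u1 v) -> edgeat (conv V) u2 (cross u2 v) ->
  edge_top V v u1 a1 -> edge_top V v u2 a2 -> proj v a1 = proj v a2 -> u1 = u2.
Proof.
move=> nc gv u11 u21 He1 He2 T1 T2.
have v0 := noncollinear_neq0 nc gv.
have u10 : u1 != 0 by rewrite -dot_gt0 u11 ltr01.
have u20 : u2 != 0 by rewrite -dot_gt0 u21 ltr01.
move=> /(proj_eqP _ _ v0)/(cross_eq0P _ v0)[t aE].
have K u : dot (cross u v) a1 = dot (cross u v) a2.
  by apply/eqP; rewrite -subr_eq0 -dotBr aE dotZr dot_crossr mulr0.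
have [c1 c10 M1] := edge_top_bottom He1 T1; have [c2 c20 M2] := edge_top_bottom He2 T2.
have h1 : 0 <= dot (cross u2 v) u1.
  have := T2.1.2 _ M1.1; rewrite -K dotDr dotNr dotZr gerDl oppr_le0.
  by rewrite pmulr_rge0.
have h2 : 0 <= dot (cross u1 v) u2.
  have := T1.1.2 _ M2.1; rewrite K dotDr dotNr dotZr gerDl oppr_le0.
  by rewrite pmulr_rge0.
have h12 : dot (cross u1 v) u2 = - dot (cross u2 v) u1 by rewrite !coordE; ring.
have z0 : dot (cross u2 v) u1 = 0 by apply/eqP; rewrite eq_le h1 andbT -oppr_ge0 -h12.
have z : cross u1 u2 = 0.
  apply/eqP/negP => /negP /(generic_direction gv (edge_direction u10 He1)
    (edge_direction u20 He2)).
  by rewrite -dot_cross_rot z0 eqxx.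
have [//|E] := unit_parallel u11 u21 z.
have A x : conv V x -> maximizer (conv V) (cross u1 v) x.
  move=> Px; apply/(maximizerP _ T1.1); split=> //; apply/eqP; rewrite eq_le.
  rewrite T1.1.2 //= E crossNl !dotNl lerN2 K; exact: T2.1.2.
have [_ _ par] := He1.
by case: (noncollinearP nc u10) => x y /A Mx /A My; apply: par.
Qed.

(** Gift wrapping: the normal [w] exposing the vertex is rotated about [v] until the exposed face
    reaches a point [b] with another projection. *)
Lemma vertex_edge_top V v y : noncollinear V -> generic V v ->
  vertex (proj_set v (conv V)) y ->
  exists u a, [/\ dot u u = 1, edgeat (conv V) u (cross u v), y = proj v a &
    forall a', edge_top V v u a' -> a' = a].
Proof.
move=> nc gv [w0 [[y0 My0] Hy]]; have v0 := noncollinear_neq0 nc gv.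
set w := proj v w0.
have wv : dot w v = 0 by apply: proj_orth.
have Mproj x : maximizer (conv V) w x -> proj v x = y.
  by move=> Mx; apply/Hy/maximizer_proj; exists x.
clearbody w.
have [a aV Ma] : exists2 a, a \in V & maximizer (conv V) w a.
  by case/maximizer_proj: My0 => x _ [Px _]; apply: face_mem_ex Px.
have Mpar x : maximizer (conv V) w x -> exists t, x = a + t *: v.
  move=> Mx; have /(cross_eq0P _ v0)[t E] : cross (x - a) v = 0.
    by apply/(proj_eqP _ _ v0); rewrite !Mproj.
  by exists t; rewrite -E addrC subrK.
have Vle x : x \in V -> dot w x <= dot w a by move=> xV; apply/Ma.2/conv_mem.
(* Otherwise all of [V] would project to the single point [y]. *)
have : [seq x <- V | dot w x < dot w a] != [::].
  apply/negP => /eqP E; apply: (noncollinearP nc v0).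
  have Z x : x \in V -> maximizer (conv V) w x.
    move=> xV; apply/(maximizerP _ Ma); split; first exact: conv_mem.
    apply/eqP; rewrite eq_le Vle //= leNgt; apply/negP => lt.
    by have := in_nil x; rewrite -E mem_filter lt xV.
  apply: conv_parallel => _ /allpairsP[[p q] [/= /Z Mp /Z Mq ->]].
  by apply/(proj_eqP _ _ v0); rewrite !Mproj.
move=> /(list_max (fun x => dot (cross v w) (a - x) / dot w (a - x)))[b].
rewrite mem_filter => /andP[ltb bV] Hb.
(* [tau] is the largest slope, which makes [n] nonnegative on every [a - x] and zero on [a - b]. *)
set tau := _ / _ in Hb.
pose n := tau *: w - cross v w.
pose u' := a - b.
have wu' : 0 < dot w u' by rewrite dotBr subr_gt0.
have nv : dot n v = 0 by rewrite /n dotDl dotZl dotNl wv dot_crossl mulr0 subr0.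
have nu' : dot n u' = 0.
  by rewrite /n dotDl dotZl dotNl /tau -/u' mulfVK ?subrr // gt_eqF.
have Mna : maximizer (conv V) n a.
  apply: maximizer_mem => // x xV; rewrite -subr_ge0 -dotBr.
  have := Vle x xV; rewrite le_eqVlt => /predU1P[E|lt].
    have /Mpar[t ->] : maximizer (conv V) w x.
      by apply/(maximizerP _ Ma); split=> //; apply: conv_mem.
    by rewrite opprD addNKr dotNr dotZr nv mulr0 oppr0.
  have := Hb x; rewrite mem_filter lt xV => /(_ isT).
  rewrite ler_pdivrMr; last by rewrite dotBr subr_gt0.
  by rewrite /n dotDl dotZl dotNl subr_ge0.
have Mnb : maximizer (conv V) n b.
  apply/(maximizerP _ Mna); split; first exact: conv_mem.
  by apply/eqP; rewrite eq_sym -subr_eq0 -dotBr nu'.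
have u'v : cross u' v != 0.
  apply/negP => /eqP/(cross_eq0P _ v0)[t E].
  by move: wu'; rewrite E dotZr wv mulr0 ltxx.
have [c nE] := orth2_parallel u'v nu' nv.
have w0' : w != 0 by apply: contraTneq wu' => ->; rewrite dot0l ltxx.
(* The sign of [c] makes [a] the head and not the tail of the edge. It is read off by computing
   [dot (cross v w) n] in two ways. *)
have c_gt0 : 0 < c.
  have vv : 0 < dot v v by rewrite dot_gt0.
  have ww : 0 < dot w w by rewrite dot_gt0.
  have E1 : dot (cross v w) n = - (dot v v * dot w w).
    transitivity (tau * dot (cross v w) w - (dot v v * dot w w) + dot w v * dot w v).
      by rewrite !coordE; ring.
    by rewrite dot_crossr wv; ring.
  have E2 : dot (cross v w) n = - (c * (dot v v * dot w u')).
    rewrite nE dotZr; transitivity (c * (dot w v * dot v u' - dot v v * dot w u')).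
      by congr (_ * _); rewrite !coordE; ring.
    by rewrite wv; ring.
  have := mulr_gt0 vv ww; have := mulr_gt0 vv wu'.
  by move: E2; rewrite E1 => /oppr_inj -> h; rewrite pmulr_lgt0.
have u'0 : u' != 0 by apply: contraTneq wu' => ->; rewrite dot0r ltxx.
have l0 := normalize_gt0 u'0; set l := (Num.sqrt (dot u' u'))^-1 in l0.
pose u := l *: u'.
have EM x : maximizer (conv V) n x <-> maximizer (conv V) (cross u v) x.
  by rewrite nE /u crossZl !maximizerZ.
have dV : direction V u.
  exists u'; first exact: diffs_mem.
  by exists l; rewrite ?gt_eqF.
exists u, a; split.
- exact: dot_normalize.
- split; first by rewrite dot_crossl.
    exists a, b; split; [exact/EM | exact/EM |].
    by apply: contraTneq ltb => ->; rewrite ltxx.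
  by apply: generic_parallel dV.
- by rewrite Mproj.
- move=> a' [/EM Ma' Ha']; have [t t0 E] := Ha' _ ((EM _).1 Mna).
  have := Ma.2 _ Ma'.1; rewrite E dotDr dotNr dotZr /u dotZr => h.
  have lw := mulr_gt0 l0 wu'.
  have -> : t = 0 by nra.
  by rewrite scale0r subr0.
Qed.

(** Sending each oriented silhouette edge to its projected head is a bijection onto the vertices of
    the projection. *)
Lemma vertices_count V v (s : seq (vec R)) k : noncollinear V -> generic V v -> uniq s ->
  (forall u, u \in s <-> edge_dir (conv V) u) ->
  nvertices (proj_set v (conv V)) k ->
  k = (\sum_(u <- s) edge_count (conv V) u v)%N.
Proof.
move=> nc gv us sE [t [ut [<- tE]]]; have v0 := noncollinear_neq0 nc gv.
(* Edge directions are chosen up to sign, but silhouette edges are oriented, so both signs are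
   listed. *)
pose S := s ++ map -%R s.
have S1 u : u \in S -> dot u u = 1.
  rewrite mem_cat => /orP[/sE[]//|/mapP[u' /sE[u'1 _] ->]].
  by rewrite dotNl dotNr opprK.
have uS : uniq S.
  rewrite cat_uniq us map_inj_uniq ?us; last exact: oppr_inj.
  rewrite andbT; apply/hasPn => _ /mapP[u /sE[_ [fu _]] ->]; apply/negP => /sE[_ [fNu _]].
  exact: first_nonzero_posN fu fNu.
pose T := [seq u <- S | edge_ind (conv V) u v].
have TP u : u \in T -> dot u u = 1 /\ edgeat (conv V) u (cross u v).
  by rewrite mem_filter => /andP[/asboolP He /S1].
(* The value [0] outside [T] is arbitrary. *)
have /choice [top Htop] : forall u, exists a, u \in T -> edge_top V v u a.
  move=> u; case: (boolP (u \in T)) => [/TP[u1 He]|]; last by exists 0.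
  have uu : 0 < dot u u by rewrite u1 ltr01.
  by have [a [Ma _ Ha]] := edge_endpoint He uu; exists a.
have uT : uniq (map (proj v \o top) T).
  rewrite map_inj_in_uniq ?filter_uniq // => u1 u2 u1T u2T /=.
  have [u11 He1] := TP _ u1T; have [u21 He2] := TP _ u2T.
  by apply: (edge_top_inj nc gv) => //; apply: Htop.
have -> : size t = size (map (proj v \o top) T).
  apply/perm_size/uniq_perm => // y; apply/idP/idP => [/tE vy|/mapP[u uinT ->]]; last first.
    apply/tE/(edge_top_vertex v0 _ (Htop _ uinT)).
    have [u1 He] := TP _ uinT.
    have u0 : u != 0 by rewrite -dot_gt0 u1 ltr01.
    exact: generic_cross_neq0 nc gv (edge_direction u0 He) u0.
  have [u [a [u1 He -> Ha]]] := vertex_edge_top nc gv vy.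
  have uinT : u \in T.
    rewrite mem_filter; apply/andP; split; first exact/asboolP.
    have u0 : u != 0 by rewrite -dot_gt0 u1 ltr01.
    rewrite mem_cat; apply/orP; case: (first_nonzero_pos_total u0) => fu; [left|right].
      by apply/sE/edge_dirP; split=> //; exists (cross u v).
    rewrite -[u]opprK; apply/map_f/sE/edge_dirP; split=> //.
      by rewrite dotNl dotNr opprK.
    by exists (cross u v); apply/edgeatN.
  by apply/mapP; exists u => //=; rewrite (Ha _ (Htop _ uinT)).
rewrite size_map size_filter count_cat count_map /edge_count big_split /=.
by congr addn; rewrite -sum1_count big_mkcond; apply: eq_bigr => u _ /=; case: edge_ind.
Qed.

End Counting.

(** * Expression of [kappa] as a sum of silhouette counts *)

Section Kappa.
Variable R : realType.
Implicit Types (c e : R) (d m n u v w x y z : vec R) (P Q : vec R -> Prop).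
Implicit Types (B V W : seq (vec R)).

(** Triple products vanish for polygons and for segments alike, so the two flat cases are treated
    together. *)
Definition coplanar V := forall d0 d1 d2, d0 \in diffs V -> d1 \in diffs V ->
  d2 \in diffs V -> dot d0 (cross d1 d2) = 0.

Lemma diffs_conv V d : d \in diffs V ->
  exists x y, conv V x /\ conv V y /\ d = x - y.
Proof.
by case/allpairsP => -[x y] [/= xV yV ->]; exists x, y; split; [|split];
  rewrite //; apply: conv_mem.
Qed.

Lemma adim2_coplanar V : adim (conv V) 2 -> coplanar V.
Proof.
move=> [_ [_ H]] d0 d1 d2 h0 h1 h2; apply/eqP/negP => /negP N.
apply: (H (fun i => [:: d0; d1; d2]`_i)); last by apply/lin_indep3P; rewrite !inordK.
by case=> -[|[|[|//]]] i; apply: diffs_conv.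
Qed.

Lemma adim1_coplanar V : adim (conv V) 1 -> coplanar V.
Proof.
move=> [_ [_ H]] d0 d1 d2 _ h1 h2; suff -> : cross d1 d2 = 0 by rewrite dot0r.
apply/eqP/negP => /negP N.
apply: (H (fun i => if i == ord0 then d1 else d2)); last exact/lin_indep2P.
by move=> i; case: ifP => _; apply: diffs_conv.
Qed.

(** If some difference [d0] is not parallel to [u], all the [cross d u] are multiples of
    [cross u d0], and only one plane matters; if there is none, they all vanish. *)
Lemma coplanar_edge_count_const B V u v v' : {subset V <= B} -> coplanar V ->
  edge_dir (conv V) u -> generic B v -> generic B v' ->
  edge_count (conv V) u v = edge_count (conv V) u v'.
Proof.
move=> VB cV /edge_dirP[u1 _ [n He]] gv gv'.
have u0 : u != 0 by rewrite -dot_gt0 u1 ltr01.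
have uV := edge_direction u0 He; have uB := direction_sub VB uV.
have [[d0 d0V h]|N] := pselect (exists2 d, d \in diffs V & cross u d != 0).
  have d0B := diffs_direction (diffs_sub VB d0V).
  apply: (@edge_count_coplanar _ _ _ _ _ (cross u d0)); try exact: (generic_direction _ uB d0B h).
  move=> d dV; apply: coplanar_cross => //.
  by case: uV => d1 d1V [c c0 ->]; rewrite crossZl dotZr cV // mulr0.
apply: edge_count_pattern => d dV.
suff E : cross d u = 0 by rewrite !dot_cross_rot E !dot0r.
apply: contra_notP N => /eqP h; exists d => //; by rewrite crossC oppr_eq0.
Qed.

Lemma kappa_polytope P k : kappa P k -> polytope P /\ exists x, P x.
Proof. by case=> [[[pP [xP _]] _]|[[[pP [xP _]]|[pP [xP _]]] _]]. Qed.

Lemma perm_sum (s t : seq (vec R)) (p : vec R -> Prop) (F : vec R -> nat) :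
  uniq s -> uniq t -> (forall u, u \in s <-> p u) -> (forall u, u \in t <-> p u) ->
  (\sum_(u <- s) F u = \sum_(u <- t) F u)%N.
Proof.
move=> us ut sE tE; apply/perm_big/uniq_perm => // u.
by apply/idP/idP => [/sE/tE|/tE/sE].
Qed.

(** In the equiprojective case the sum counts the vertices of a projection, and its constancy forces
    that of each term. In the flat case the terms are first shown constant, hence equal to the
    multiplicities. *)
Lemma kappa_edge_count B V k (s : seq (vec R)) : {subset V <= B} -> kappa (conv V) k ->
  uniq s -> (forall u, u \in s <-> edge_dir (conv V) u) ->
  (forall u v v', edge_dir (conv V) u -> generic B v -> generic B v' ->
     edge_count (conv V) u v = edge_count (conv V) u v') /\
  (forall v, generic B v -> k = (\sum_(u <- s) edge_count (conv V) u v)%N).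
Proof.
move=> VB kV us sE.
have [[[_ aV] Hk]|[flat [t [ut [tE ->]]]]] := kV.
  have nc := adim3_noncollinear aV.
  have K v : generic B v -> k = (\sum_(u <- s) edge_count (conv V) u v)%N.
    move=> /(generic_sub VB) gv; have v0 := noncollinear_neq0 nc gv.
    by apply: vertices_count => //; apply: (Hk v v0 (generic_facet gv)).2.
  by split=> //; apply: edge_count_const K.
have cV : coplanar V by case: flat => -[_]; [apply: adim2_coplanar | apply: adim1_coplanar].
have C u v v' : edge_dir (conv V) u -> generic B v -> generic B v' ->
    edge_count (conv V) u v = edge_count (conv V) u v'.
  exact: coplanar_edge_count_const.
split=> // v gv; rewrite (perm_sum _ ut us tE sE); apply: eq_big_seq => u /sE du.
by rewrite (edge_count_mult VB) // => v1 v2; apply: C.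
Qed.

(** * Minkowski sums and comparison of the counts *)

Lemma maximizer_minkowski P Q n z : maximizer (minkowski P Q) n z <->
  exists x y, [/\ maximizer P n x, maximizer Q n y & z = x + y].
Proof.
split=> [[[x [y [Px [Qy zE]]]] H]|[x [y [Mx My ->]]]].
  exists x, y; split=> //; split=> // t ht.
    have : minkowski P Q (t + y) by exists t, y.
    by move=> /H; rewrite zE !dotDr lerD2r.
  have : minkowski P Q (x + t) by exists x, t.
  by move=> /H; rewrite zE !dotDr lerD2l.
split; first by exists x, y; split; [case: Mx | split; first by case: My].
by move=> _ [x' [y' [Px' [Qy' ->]]]]; rewrite !dotDr lerD //; [apply: Mx.2 | apply: My.2].
Qed.

Lemma edge_ind_two B V u v : generic B v -> {subset V <= B} -> direction B u ->
  edge_ind (conv V) u v <->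
  exists x y, [/\ maximizer (conv V) (cross u v) x,
                  maximizer (conv V) (cross u v) y & x != y].
Proof.
move=> gv VB uB; split=> [/asboolP[]//|H]; apply/asboolP; split=> //.
  by rewrite dot_crossl.
exact: generic_parallel gv VB uB.
Qed.

(** A sum of two faces contains two distinct points exactly when one of the faces does. *)
Lemma edge_ind_minkowski B V W Z u v : generic B v -> {subset V <= B} ->
  {subset W <= B} -> {subset Z <= B} -> V != [::] -> W != [::] ->
  minkowski (conv V) (conv W) = conv Z -> direction B u ->
  edge_ind (conv Z) u v = edge_ind (conv V) u v || edge_ind (conv W) u v.
Proof.
move=> gv VB WB ZB V0 W0 ZE uB; apply/idP/orP.
  move=> /(edge_ind_two gv ZB uB)[p [q []]].
  rewrite -ZE => /maximizer_minkowski[x [y [Mx My ->]]].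
  move=> /maximizer_minkowski[x' [y' [Mx' My' ->]]] h.
  have [xx'|xx'] := eqVneq x x'; [right|left]; apply/(edge_ind_two gv _ uB) => //.
    by exists y, y'; split=> //; apply: contra_neq h => ->; rewrite xx'.
  by exists x, x'.
have [a _ Ma] := maximizer_ex (cross u v) V0; have [b _ Mb] := maximizer_ex (cross u v) W0.
have M x y : maximizer (conv V) (cross u v) x -> maximizer (conv W) (cross u v) y ->
    maximizer (conv Z) (cross u v) (x + y).
  by move=> Mx My; rewrite -ZE; apply/maximizer_minkowski; exists x, y.
case=> [/(edge_ind_two gv VB uB)|/(edge_ind_two gv WB uB)] [x [x' [Mx Mx' h]]];
  apply/(edge_ind_two gv ZB uB).
  exists (x + b), (x' + b); split; try exact: M.
  by apply: contra_neq h => /addIr.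
exists (a + x), (a + x'); split; try exact: M.
by apply: contra_neq h => /addrI.
Qed.

Lemma edge_dir_generic B V u : {subset V <= B} -> edge_dir (conv V) u ->
  direction B u /\ exists2 v, generic B v & edge_ind (conv V) u v.
Proof.
move=> VB /edge_dirP[u1 _ [n He]].
have u0 : u != 0 by rewrite -dot_gt0 u1 ltr01.
split; first exact: direction_sub VB (edge_direction u0 He).
have [z gz] := generic_ex B.
have [e _ [[h1 _] h2]] := small_ex (small_and (edge_approach z u1 He)
  (generic_perturb (cross n u) gz)).
by exists (cross n u + e *: z).
Qed.

Lemma edge_ind_dir V u v : dot u u = 1 -> first_nonzero_pos u ->
  edge_ind (conv V) u v -> edge_dir (conv V) u.
Proof. by move=> u1 fu /asboolP He; apply/edge_dirP; split=> //; exists (cross u v). Qed.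

Lemma edge_dir_minkowski B V W Z u : {subset V <= B} ->
  {subset W <= B} -> {subset Z <= B} -> V != [::] -> W != [::] ->
  minkowski (conv V) (conv W) = conv Z ->
  edge_dir (conv Z) u <-> edge_dir (conv V) u \/ edge_dir (conv W) u.
Proof.
move=> VB WB ZB V0 W0 ZE; split=> [du|[] du]; have [u1 [fu _]] := du.
- have [uB [v gv h]] := edge_dir_generic ZB du; move: h.
  rewrite (edge_ind_minkowski gv VB WB ZB V0 W0 ZE uB) => /orP[|] h; [left|right];
  exact: edge_ind_dir h.
- have [uB [v gv h]] := edge_dir_generic VB du; apply: (@edge_ind_dir _ _ v) => //.
  by rewrite (edge_ind_minkowski gv VB WB ZB V0 W0 ZE uB) h.
- have [uB [v gv h]] := edge_dir_generic WB du; apply: (@edge_ind_dir _ _ v) => //.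
  by rewrite (edge_ind_minkowski gv VB WB ZB V0 W0 ZE uB) h orbT.
Qed.

Lemma edge_count_out V u v : dot u u = 1 -> first_nonzero_pos u ->
  ~ edge_dir (conv V) u -> edge_count (conv V) u v = 0%N.
Proof.
move=> u1 fu N; rewrite /edge_count.
have -> : edge_ind (conv V) u v = false by apply/negP => /(edge_ind_dir u1 fu).
have -> // : edge_ind (conv V) (- u) v = false.
apply/negP => /asboolP/edgeatN He; apply/N/edge_dirP; split=> //.
by exists (cross (- u) v).
Qed.

(** [w] may lie on the boundary of the normal cone of the edge; adding a positive multiple of [n]
    brings it into the relative interior. *)
Lemma edgeat_add V u n w : dot w u = 0 -> edgeat (conv V) u n ->
  (forall x, maximizer (conv V) n x -> maximizer (conv V) w x) ->
  forall e, 0 < e -> edgeat (conv V) u (w + e *: n).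
Proof.
move=> wu He sub e e0; have [nu [a [b [Ma Mb ab]]] par] := He.
have [Mwa Mwb] := (sub _ Ma, sub _ Mb).
have ME x : maximizer (conv V) n x <-> maximizer (conv V) (w + e *: n) x.
  have Mea : maximizer (conv V) (w + e *: n) a.
    split=> [|y Py]; first by case: Ma.
    by rewrite !dotDl !dotZl lerD ?(Mwa.2 y Py) // ler_pM2l // Ma.2.
  split=> [Mx|[Px Hx]].
    apply/(maximizerP _ Mea); split; first by case: Mx.
    by rewrite !dotDl !dotZl (maximizer_eq Mx Ma) (maximizer_eq (sub _ Mx) Mwa).
  apply/(maximizerP _ Ma); split=> //; apply/eqP; rewrite eq_le Ma.2 //=.
  have := Hx _ Ma.1; have := Mwa.2 _ Px; rewrite !dotDl !dotZl => h1 h2.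
  by rewrite -(ler_pM2l e0); lra.
by apply: edgeat_face ME He; rewrite dotDl dotZl nu wu mulr0 addr0.
Qed.

(** A vector [w] of the first cone is approximated by [w + e *: n], which exposes an edge, and this
    by generic rays. They lie in the second cone, and closedness carries the inclusion back to
    [w]. *)
Lemma agg_cone_subset B V W u : dot u u = 1 ->
  (forall v, generic B v -> edge_ind (conv V) u v -> edge_ind (conv W) u v) ->
  Defs.subset (agg_cone (conv V) u) (agg_cone (conv W) u).
Proof.
move=> u1 H w aw; have u0 : u != 0 by rewrite -dot_gt0 u1 ltr01.
have wu : dot w u = 0 by rewrite dotC; apply: agg_cone_orth aw.
have /agg_coneP-/(_ u0)[n He sub] := aw; have [nu _ _] := He.
have [e e0 We] := small_ex (perturb W w n).
have He' := edgeat_add wu He sub e0.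
have n'u : dot (w + e *: n) u = 0 by rewrite dotDl dotZl wu nu mulr0 addr0.
have [z gz] := generic_ex B.
have [t _ [[h1 _] [h2 h3]]] := small_ex (small_and (edge_approach z u1 He')
  (small_and (generic_perturb (cross (w + e *: n) u) gz) (agg_cone_limit W u1 n'u z))).
have /agg_coneP-/(_ u0)[m Hm subm] := h3 (H _ h2 h1).
by apply/agg_coneP => //; exists m => // x /subm/We[].
Qed.

Lemma agg_cone_subset_ind B V W u v : {subset V <= B} -> {subset W <= B} ->
  generic B v -> direction B u -> u != 0 ->
  Defs.subset (agg_cone (conv V) u) (agg_cone (conv W) u) ->
  (edge_ind (conv V) u v -> edge_ind (conv W) u v) /\
  (edge_ind (conv V) (- u) v -> edge_ind (conv W) (- u) v).
Proof.
move=> VB WB gv uB u0 sub; split=> h.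
  by apply/(edge_ind_agg gv WB uB u0)/sub/(edge_ind_agg gv VB uB u0).
by apply/(edge_indN_agg gv WB uB u0)/sub/(edge_indN_agg gv VB uB u0).
Qed.

(* If neither cone is the whole plane, each of them contains exactly one ray of every
   generic line. Hence inclusion forces equality, and otherwise some generic line,
   hence every generic line, has both of its rays in the union. *)
Lemma edge_count_minkowski B V W Z u v : {subset V <= B} ->
  {subset W <= B} -> {subset Z <= B} -> V != [::] -> W != [::] ->
  minkowski (conv V) (conv W) = conv Z ->
  edge_dir (conv V) u -> edge_dir (conv W) u ->
  (forall v, generic B v -> edge_count (conv V) u v = mult (conv V) u) ->
  (forall v, generic B v -> edge_count (conv W) u v = mult (conv W) u) ->
  (forall v v', generic B v -> generic B v' ->
     edge_count (conv Z) u v = edge_count (conv Z) u v') ->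
  generic B v ->
  let aV := agg_cone (conv V) u in let aW := agg_cone (conv W) u in
  let nested := (~ cfull (conv V) u \/ ~ cfull (conv W) u) /\
                (Defs.subset aV aW \/ Defs.subset aW aV) in
  let full := cfull (conv V) u /\ cfull (conv W) u in
  (edge_count (conv Z) u v + (`[< nested >] + 2 * `[< full >]) =
   edge_count (conv V) u v + edge_count (conv W) u v)%N.
Proof.
move=> VB WB ZB V0 W0 ZE dV dW cV cW cZ gv aV aW nested full.
have [u1 [fu _]] := dV; have u0 : u != 0 by rewrite -dot_gt0 u1 ltr01.
have [uB _] := edge_dir_generic VB dV; have uNB := directionN uB.
have EZ t : generic B t -> edge_count (conv Z) u t =
    ((edge_ind (conv V) u t || edge_ind (conv W) u t) +
     (edge_ind (conv V) (- u) t || edge_ind (conv W) (- u) t))%N.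
  by move=> gt; rewrite /edge_count !(edge_ind_minkowski gt VB WB ZB V0 W0 ZE).
have orthV w : aV w -> orth u w by apply: agg_cone_orth.
have orthW w : aW w -> orth u w by apply: agg_cone_orth.
have := cV v gv; have := cW v gv; rewrite EZ //.
(* A full cone contains the other one; in these cases the identity is checked on the values of the
   four indicators. *)
have [fV|nV] := pselect (cfull (conv V) u); have [fW|nW] := pselect (cfull (conv W) u).
- have -> : mult (conv V) u = 2%N by rewrite /mult asboolT.
  have -> : mult (conv W) u = 2%N by rewrite /mult asboolT.
  have -> : `[< nested >] = false by apply/asboolP => -[[]].
  have -> : `[< full >] = true by apply/asboolP.
  by rewrite /edge_count; do 4!case: edge_ind.
- have -> : mult (conv V) u = 2%N by rewrite /mult asboolT.
  have -> : mult (conv W) u = 1%N by rewrite /mult asboolF.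
  have -> : `[< nested >] = true.
    by apply/asboolP; split; [right | right=> w /orthW/fV].
  have -> : `[< full >] = false by apply/asboolP => -[].
  by rewrite /edge_count; do 4!case: edge_ind.
- have -> : mult (conv V) u = 1%N by rewrite /mult asboolF.
  have -> : mult (conv W) u = 2%N by rewrite /mult asboolT.
  have -> : `[< nested >] = true.
    by apply/asboolP; split; [left | left=> w /orthV/fW].
  have -> : `[< full >] = false by apply/asboolP => -[].
  by rewrite /edge_count; do 4!case: edge_ind.
have multV : mult (conv V) u = 1%N by rewrite /mult asboolF.
have multW : mult (conv W) u = 1%N by rewrite /mult asboolF.
have -> : `[< full >] = false by apply/asboolP => -[].
rewrite multV multW; case: asboolP => [[_ [sub|sub]]|N].
- have [] := agg_cone_subset_ind VB WB gv uB u0 sub.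
  by move=> /implyP + /implyP; rewrite /edge_count; do 4!case: edge_ind.
- have [] := agg_cone_subset_ind WB VB gv uB u0 sub.
  by move=> /implyP + /implyP; rewrite /edge_count; do 4!case: edge_ind.
move=> eW eV; rewrite -EZ // eW eV; apply: contra_notP N => NZ.
split; first by left.
left; apply: (agg_cone_subset u1) => t gt hV.
have := cV t gt; have := cW t gt; move: NZ; rewrite (cZ _ _ gv gt) EZ //.
rewrite multV multW /edge_count hV /=.
by do 3!case: edge_ind.
Qed.

Lemma sum_sub (s t : seq (vec R)) (F : vec R -> nat) : uniq s -> uniq t ->
  {subset s <= t} -> (forall u, u \in t -> u \notin s -> F u = 0%N) ->
  (\sum_(u <- s) F u = \sum_(u <- t) F u)%N.
Proof.
move=> us ut st F0; transitivity (\sum_(u <- t | u \in s) F u)%N.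
  rewrite -[RHS]big_filter; apply/perm_big/uniq_perm; rewrite ?filter_uniq // => u.
  by rewrite mem_filter; apply/idP/andP => [h|[]//]; split=> //; apply: st.
by rewrite big_mkcond; apply: eq_big_seq => u /F0; case: ifP => // _ ->.
Qed.

Lemma size_sub (s t : seq (vec R)) : uniq s -> uniq t -> {subset s <= t} ->
  size s = (\sum_(u <- t) (u \in s))%N.
Proof.
move=> us ut st; rewrite -(sum_sub us ut st) => [|u _ /negPf -> //].
by rewrite -sum1_size; apply: eq_big_seq => u ->.
Qed.

End Kappa.

(** Subtraction of naturals truncates, so [l] is added on the left. *)
Theorem theorem4p4 (R : realType) (P Q : vec R -> Prop) :
  (equiprojective P \/ polygon P \/ segment P) ->
  (equiprojective Q \/ polygon Q \/ segment Q) ->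
  equiprojective (minkowski P Q) ->
  forall kP kQ kPQ l : nat,
    kappa P kP -> kappa Q kQ -> kappa (minkowski P Q) kPQ -> lambda P Q l ->
    (kPQ + l)%N = (kP + kQ)%N.
Proof.
move=> _ _ _ kP kQ kPQ l hP hQ hPQ [s1 [s2 [us1 [us2 [s1E [s2E ->]]]]]].
have [[V PE] [x0 Px0]] := kappa_polytope hP.
have [[W QE] [y0 Qy0]] := kappa_polytope hQ.
have [[Z ZE] _] := kappa_polytope hPQ.
have {PE}PE : P = conv V by apply/funext => x; apply/propext.
have {QE}QE : Q = conv W by apply/funext => x; apply/propext.
subst P Q.
have {}ZE : minkowski (conv V) (conv W) = conv Z by apply/funext => x; apply/propext.
rewrite ZE in hPQ.
have V0 := conv_neq0 Px0; have W0 := conv_neq0 Qy0.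
pose B := V ++ W ++ Z.
have VB : {subset V <= B} by move=> x h; rewrite mem_cat h.
have WB : {subset W <= B} by move=> x h; rewrite !mem_cat h orbT.
have ZB : {subset Z <= B} by move=> x h; rewrite !mem_cat h !orbT.
have [sV [usV sVE]] := edge_dirs_ex V.
have [sW [usW sWE]] := edge_dirs_ex W.
have [sZ [usZ sZE]] := edge_dirs_ex Z.
have dZ u := edge_dir_minkowski u VB WB ZB V0 W0 ZE.
have [cV sumV] := kappa_edge_count VB hP usV sVE.
have [cW sumW] := kappa_edge_count WB hQ usW sWE.
have [cZ sumZ] := kappa_edge_count ZB hPQ usZ sZE.
have [v gv] := generic_ex B.
have subV : {subset sV <= sZ} by move=> u /sVE h; apply/sZE/dZ; left.
have subW : {subset sW <= sZ} by move=> u /sWE h; apply/sZE/dZ; right.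
have sub1 : {subset s1 <= sZ} by move=> u /s1E[h _]; apply/sZE/dZ; left.
have sub2 : {subset s2 <= sZ} by move=> u /s2E[h _]; apply/sZE/dZ; left.
rewrite (sumV v gv) (sumW v gv) (sumZ v gv).
(* All four terms become sums over the edge directions of the Minkowski sum, the added directions
   contributing zero; the identity is then proved direction by direction. *)
rewrite (sum_sub usV usZ subV); last first.
  move=> u /sZE[u1 [fu _]] /negP uV; apply: edge_count_out => // /sVE; exact: uV.
rewrite (sum_sub usW usZ subW); last first.
  move=> u /sZE[u1 [fu _]] /negP uW; apply: edge_count_out => // /sWE; exact: uW.
rewrite (size_sub us1 usZ sub1) (size_sub us2 usZ sub2) big_distrr /= -!big_split /=.
apply: eq_big_seq => u /sZE du; have [u1 [fu _]] := du.
(* A direction of only one summand contributes nothing to [l], and there the count of the sum is the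
   count of that summand. *)
have [dV|nV] := pselect (edge_dir (conv V) u); last first.
  have -> : (u \in s1) = false by apply/negP => /s1E[].
  have -> : (u \in s2) = false by apply/negP => /s2E[].
  have dW : edge_dir (conv W) u by case/dZ: du.
  have [uB _] := edge_dir_generic WB dW.
  have := edge_count_out v u1 fu nV.
  rewrite /edge_count !(edge_ind_minkowski gv VB WB ZB V0 W0 ZE) //; last exact: directionN.
  by do 4!case: edge_ind.
have [uB _] := edge_dir_generic VB dV.
have [dW|nW] := pselect (edge_dir (conv W) u); last first.
  have -> : (u \in s1) = false by apply/negP => /s1E[_ []].
  have -> : (u \in s2) = false by apply/negP => /s2E[_ []].
  have := edge_count_out v u1 fu nW.
  rewrite /edge_count !(edge_ind_minkowski gv VB WB ZB V0 W0 ZE) //; last exact: directionN.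
  by do 4!case: edge_ind.
have mV t : generic B t -> edge_count (conv V) u t = mult (conv V) u.
  by apply: edge_count_mult => // v1 v2; apply: cV.
have mW t : generic B t -> edge_count (conv W) u t = mult (conv W) u.
  by apply: edge_count_mult => // v1 v2; apply: cW.
have mZ t t' : generic B t -> generic B t' ->
    edge_count (conv Z) u t = edge_count (conv Z) u t' by apply: cZ.
rewrite -(edge_count_minkowski VB WB ZB V0 W0 ZE dV dW mV mW mZ gv) /=.
congr (_ + (nat_of_bool _ + 2 * nat_of_bool _))%N.
  by apply/idP/asboolP => [/s1E[_ [_ []]]|[h1 h2]] //; apply/s1E.
by apply/idP/asboolP => [/s2E[_ [_ []]]|[h1 h2]] //; apply/s2E.
Qed.
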